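(* Let $\Omega\subset\mathbb{R}^2$ be a nonempty connected open set such that $\mathbb{R}^2\setminus\Omega$ contains at least two points. Let $(\Omega_\nu)$ be a sequence of bounded connected open sets with smooth boundary such that $\Omega_\nu\subset\subset\Omega_{\nu+1}$ and $\Omega_\nu\nearrow\Omega$, in the sense that any compact $K\subset\Omega$ is contained in $\Omega_\nu$ for large $\nu$. For each $\nu$ let $u_\nu\in C^\infty(\Omega_\nu)$ be the solution of $\Delta u_\nu=e^{2u_\nu}$ on $\Omega_\nu$ with $u_\nu=+\infty$ on $\partial\Omega_\nu$ for which $e^{2u_\nu}\delta_{jk}$ is a complete metric tensor on $\Omega_\nu$ (the Poincaré metric of $\Omega_\nu$). Then $$u_\nu\searrow u \quad\text{as } \nu\nearrow\infty,$$ where $u\in C^\infty(\Omega)$ solves $\Delta u=e^{2u}$ on $\Omega$, and the metric tensor $g_{jk}=e^{2u}\delta_{jk}$ is a complete metric tensor on $\Omega$, of Gauss curvature $-1$.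
   Context: $\Delta$ is the Euclidean Laplacian $\partial_{x_1}^2+\partial_{x_2}^2$ and $\delta_{jk}$ the Euclidean metric tensor on $\mathbb{R}^2$. A Poincaré metric on a planar domain is a complete metric of the form $e^{2w}\delta_{jk}$ with Gauss curvature $\equiv -1$; it is unique if it exists, and it exists on each $\Omega_\nu$. The condition $u_\nu=+\infty$ on $\partial\Omega_\nu$ means $u_\nu(p)\to+\infty$ as $p\to\partial\Omega_\nu$; $u_\nu$ is the increasing limit, as $a\nearrow\infty$, of the solutions $u_{\nu,a}\in C^\infty(\overline{\Omega}_\nu)$ of the same equation with boundary value the constant $a$. The notation $u_\nu\searrow u$ means that at each point $p\in\Omega$ the numbers $u_\nu(p)$ (defined for $\nu$ large) decrease to $u(p)$. *)

(* Defs.v *)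
From HB Require Import structures.
From mathcomp Require Import all_boot all_order all_algebra.
From mathcomp Require Import all_classical all_reals all_analysis.
Set Implicit Arguments.
Unset Strict Implicit.
Unset Printing Implicit Defensive.
Import Order.TTheory GRing.Theory Num.Theory.
Import numFieldNormedType.Exports.
Local Open Scope classical_set_scope.
Local Open Scope ring_scope.

(* R^2 is 'rV[R]_2. Its library norm is the sup norm, which is used below only
   for the topology; Euclidean lengths come from the metric tensors. Functions
   on a planar domain are total functions of which only the values on the domain
   matter: the domains are open, so derivatives at their points do not see the
   values elsewhere. *)

Section calculus.
Variable R : realType.
Implicit Types (f u : 'rV[R]_2 -> R) (p : 'rV[R]_2) (W : set 'rV[R]_2).

Definition pderiv (i : 'I_2) f : 'rV[R]_2 -> R :=
  fun p => 'D_(delta_mx 0 i) f p.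

Definition iter_pderiv (s : seq 'I_2) f : 'rV[R]_2 -> R := foldr pderiv f s.

(* C^oo on the open set W *)
Definition smooth_on W f : Prop :=
  forall (s : seq 'I_2) p, W p ->
    {for p, continuous (iter_pderiv s f)} /\
    (forall i : 'I_2, derivable (iter_pderiv s f) p (delta_mx 0 i)).

Definition laplacian f : 'rV[R]_2 -> R :=
  fun p => \sum_(i < 2) pderiv i (pderiv i f) p.

End calculus.

Section domains.
Variable R : realType.
Implicit Types (W V : set 'rV[R]_2) (u : 'rV[R]_2 -> R).

Definition bdry W : set 'rV[R]_2 := closure W `\` interior W.

(* Near each boundary point, W is the negativity set of a smooth function
   without critical points. *)
Definition smooth_boundary W : Prop :=
  forall p, bdry W p ->
    exists (U : set 'rV[R]_2) (rho : 'rV[R]_2 -> R),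
      [/\ open U, U p, smooth_on U rho,
          (forall q, U q -> exists i : 'I_2, pderiv i rho q != 0) &
          W `&` U = [set q | U q /\ rho q < 0]].

(* W is relatively compact in V *)
Definition compactly_inside W V : Prop :=
  compact (closure W) /\ closure W `<=` V.

(* u(p) -> +oo as the distance from p in W to the boundary tends to 0 *)
Definition boundary_blowup W u : Prop :=
  forall M : R, exists2 e : R, 0 < e &
    forall p q, W p -> bdry W q -> `|p - q| < e -> M < u p.

End domains.

Section riemannian.
Variable R : realType.
Implicit Types (W : set 'rV[R]_2) (p q v : 'rV[R]_2).
Implicit Types (g : 'rV[R]_2 -> 'M[R]_2) (c : R -> 'rV[R]_2).

Definition gnorm2 g p v : R := (v *m g p *m v^T) 0 0.

Definition metric_tensor W g : Prop :=
  (forall i j : 'I_2, smooth_on W (fun p => g p i j)) /\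
  (forall p, W p -> (g p)^T = g p /\
     forall v : 'rV[R]_2, v != 0 -> 0 < gnorm2 g p v).

(* The restriction of c to [0, 1] is the arc. Asking for c to be C^1 on all of R
   is no restriction: a C^1 map on [0, 1] extends affinely to both sides. *)
Definition C1_arc W c : Prop :=
  [/\ forall t : R, derivable c t 1,
      continuous (derive1 c) &
      forall t : R, 0 <= t <= 1 -> W (c t)].

Definition arc_length g c : \bar R :=
  (\int[lebesgue_measure]_(t in `[0%R, 1%R])
     (Num.sqrt (gnorm2 g (c t) (derive1 c t)))%:E)%E.

(* A piecewise C^1 path from p to q is a list of C^1 arcs laid end to end. *)
Fixpoint path_between W p (cs : seq (R -> 'rV[R]_2)) q : Prop :=
  if cs is c :: cs' then
    [/\ C1_arc W c, c 0 = p & path_between W (c 1) cs' q]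
  else p = q.

Definition path_length g (cs : seq (R -> 'rV[R]_2)) : \bar R :=
  (\sum_(c <- cs) arc_length g c)%E.

Definition riem_dist W g p q : \bar R :=
  ereal_inf [set path_length g cs | cs in [set cs | path_between W p cs q]].

Definition riem_complete W g : Prop :=
  forall x : nat -> 'rV[R]_2, (forall n, W (x n)) ->
    (forall e : R, 0 < e -> exists N : nat, forall m n : nat,
       (N <= m)%N -> (N <= n)%N -> (riem_dist W g (x m) (x n) < e%:E)%E) ->
    exists2 p, W p &
      forall e : R, 0 < e -> exists N : nat, forall n : nat,
        (N <= n)%N -> (riem_dist W g (x n) p < e%:E)%E.

Definition complete_metric_tensor W g : Prop :=
  metric_tensor W g /\ riem_complete W g.

(* Gamma^l_ij *)
Definition christoffel g (l i j : 'I_2) : 'rV[R]_2 -> R := fun p =>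
  2^-1 * \sum_(m < 2) invmx (g p) l m *
    (pderiv i (fun q => g q m j) p + pderiv j (fun q => g q m i) p
     - pderiv m (fun q => g q i j) p).

(* The coefficient of d_l in R(d_i, d_j) d_k, where
   R(X, Y) Z = D_X D_Y Z - D_Y D_X Z - D_[X, Y] Z for the Levi-Civita
   connection D. *)
Definition riemann_curv g (l i j k : 'I_2) : 'rV[R]_2 -> R := fun p =>
  pderiv i (christoffel g l j k) p - pderiv j (christoffel g l i k) p
  + \sum_(m < 2) (christoffel g l i m p * christoffel g m j k p
                  - christoffel g l j m p * christoffel g m i k p).

(* K = g(R(d_1, d_2) d_2, d_1) / det g *)
Definition gauss_curvature g : 'rV[R]_2 -> R := fun p =>
  (\sum_(l < 2) g p 0 l * riemann_curv g l 0 1 1 p) / \det (g p).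

(* e^(2u) delta_jk *)
Definition conformal (u : 'rV[R]_2 -> R) : 'rV[R]_2 -> 'M[R]_2 :=
  fun p => (expR (2 * u p))%:M.

End riemannian.

(* Main.v *)
Require Import Defs.
From HB Require Import structures.
From mathcomp Require Import all_boot all_order all_algebra.
From mathcomp Require Import all_classical all_reals all_analysis.
From mathcomp Require Import measurable_realfun ring lra.
Import Order.TTheory GRing.Theory Num.Theory.
Import numFieldNormedType.Exports.
Local Open Scope classical_set_scope.
Local Open Scope ring_scope.

Set Implicit Arguments.
Unset Strict Implicit.
Unset Printing Implicit Defensive.

(**
Everything rests on the maximum principle and explicit comparison functions;
integrals occur only in lengths of arcs.

Comparison. Where a subsolution of [laplacian u = expR (2 * u)] exceeds a
supersolution, the Laplacian of the difference is positive, so the difference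
has no interior maximum there ([comparison]). As [un n] is infinite on the
boundary of [Omn n], where [un n.+1] is finite, [un n.+1 <= un n]. Two points [a]
and [b] outside [Om] give an explicit metric [expR (2 * w)] of curvature at most
-1 on the plane without [a] and [b]; the same principle gives [w <= un n]
([two_puncture_lower]). Hence [un] converges pointwise to some [u].

Regularity. A reflection and a quadratic barrier bound the gradient of a function
by the function and its Laplacian on a square ([gradient_estimate]). Applied to
[un n], which is locally bounded together with its Laplacian, the estimate makes
the sequence equi-Lipschitz, so that the convergence is locally uniform
([un_ccvg]). Applied to the differences of a sequence that converges locally
uniformly together with its Laplacian, it makes the first derivatives converge
locally uniformly ([ccvg_pderiv]). Since the Laplacian of [un n] is
[expR (2 * un n)], one more derivative converges at each turn ([Ck_elliptic]), so
[u] is smooth and solves the equation.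

Completeness. For a point [a] outside [Om], with [r] the distance to [a],
comparison with the Poincare metrics of a punctured disc and of the exterior of a
disc gives [u >= - ln (r * (C + `|ln r|))] on all of [Om] ([log_bound]). So a
multiple of [ln (1 + (2 * ln r) ^+ 2)] is 1-Lipschitz for the metric
([riem_dist_height]). That function tends to infinity when [r] tends to 0 and to
infinity: a Cauchy sequence stays bounded and away from each [a] outside [Om],
hence accumulates at a point of [Om], near which the metric is comparable to the
Euclidean one ([conformal_complete]).

Curvature. The curvature of [expR (2 * u)] times the Euclidean metric is
[- laplacian u / expR (2 * u)] ([gauss_curvature_conformal]).
*)

(** * The plane with its sup norm *)

Section plane.
Context {R : realType}.
Implicit Types (f g : 'rV[R]_2 -> R) (p q v x : 'rV[R]_2) (i j : 'I_2).

Lemma coord_le_norm x i : `|x 0 i| <= `|x|.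
Proof.
rewrite [leRHS]/Num.Def.normr/= mx_normrE.
exact: (le_bigmax _ (fun ij => `|x ij.1 ij.2|) (0, i)).
Qed.

Lemma norm_lt_coord x (e : R) : 0 < e -> (forall i, `|x 0 i| < e) -> `|x| < e.
Proof.
move=> e0 h; rewrite [ltLHS]/Num.Def.normr/= mx_normrE.
by apply/bigmax_ltP; split => // -[a b] _ /=; rewrite ord1.
Qed.

Lemma norm_le_coord x (e : R) : 0 <= e -> (forall i, `|x 0 i| <= e) -> `|x| <= e.
Proof.
move=> e0 h; rewrite [leLHS]/Num.Def.normr/= mx_normrE.
by apply/bigmax_leP; split => // -[a b] _ /=; rewrite ord1.
Qed.

Lemma norm_unit i : `|delta_mx 0 i : 'rV[R]_2| = 1.
Proof.
apply/eqP; rewrite eq_le; apply/andP; split.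
  apply: norm_le_coord => // j; rewrite mxE eqxx /=.
  by case: eqP => _; rewrite ?normr1 ?normr0.
by apply: le_trans (coord_le_norm _ i); rewrite mxE !eqxx normr1.
Qed.

Lemma norm_scale_unit (s : R) i : `|s *: (delta_mx 0 i : 'rV[R]_2)| = `|s|.
Proof. by rewrite normrZ norm_unit mulr1. Qed.

Lemma continuous_coord i : continuous (fun x : 'rV[R]_2 => x 0 i).
Proof. exact: coord_continuous. Qed.

Lemma is_derive_line f p v (t df : R) :
  is_derive (p + t *: v) v f df <-> is_derive t 1 (fun s : R => f (p + s *: v)) df.
Proof.
have E : (fun h : R => h^-1 *: ((f \o shift (p + t *: v)) (h *: v) - f (p + t *: v))) =
   (fun h : R => h^-1 *: (((fun s : R => f (p + s *: v)) \o shift t) (h *: 1) - f (p + t *: v))).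
  apply/funext => h /=; congr (_ *: (f _ - _)).
  by rewrite [_%:A]mulr1 scalerDl [in RHS]addrCA addrA addrC addrA.
split=> -[d1 d2]; split.
- by move: d1; rewrite /derivable E.
- by move: d2; rewrite /derive E.
- by rewrite /derivable E.
- by rewrite /derive E.
Qed.

Lemma is_derive_line0 f p v (df : R) :
  is_derive p v f df <-> is_derive (0 : R) 1 (fun s : R => f (p + s *: v)) df.
Proof. by rewrite -is_derive_line scale0r addr0. Qed.

Lemma is_derive_comp (F : R -> R) f p v (a b : R) :
  is_derive (f p) 1 F a -> is_derive p v f b ->
  is_derive p v (fun x => F (f x)) (a * b).
Proof.
move=> hF /is_derive_line0 hf; apply/is_derive_line0.
have hF' : is_derive (f (p + 0 *: v)) 1 F a by rewrite scale0r addr0.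
exact: (@is_derive1_comp R F (fun s : R => f (p + s *: v)) 0 a b hF' hf).
Qed.

Lemma is_derive_coord x v i : is_derive x v (fun y : 'rV[R]_2 => y 0 i) (v 0 i).
Proof.
apply/is_derive_line0.
have -> : (fun s : R => (x + s *: v) 0 i) = (fun s : R => x 0 i + s * v 0 i).
  by apply/funext => s; rewrite !mxE.
apply: is_derive_eq; rewrite /GRing.scale/=; ring.
Qed.

Lemma mvt_line f p v (h : R) :
  (forall s : R, `|s| <= `|h| -> derivable f (p + s *: v) v) ->
  exists2 s : R, `|s| <= `|h| & f (p + h *: v) - f p = 'D_v f (p + s *: v) * h.
Proof.
move=> df.
pose g : R -> R := fun s : R => f (p + s *: v).
pose dg : R -> R := fun s : R => 'D_v f (p + s *: v).
have dgE (s : R) : `|s| <= `|h| -> is_derive s 1 g (dg s).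
  by move=> hs; apply/is_derive_line; exact/derivableP/df.
have cg (s : R) : `|s| <= `|h| -> {for s, continuous g}.
  move=> hs; apply: differentiable_continuous; apply/derivable1_diffP.
  by case: (dgE s hs).
have g0 : g 0 = f p by rewrite /g scale0r addr0.
have [h0|h0] := leP 0 h.
  have P (s : R) : s \in `[0, h] -> `|s| <= `|h|.
    by rewrite in_itv/= => /andP[s0 sh]; rewrite !ger0_norm.
  have wg : {within `[0, h], continuous g}.
    by apply: continuous_in_subspaceT => s /[!inE] /P /cg.
  have [s s1 s2] := @MVT_segment R g dg 0 h h0
    (fun s hs => dgE s (P s (subset_itv_oo_cc hs))) wg.
  exists s; first exact: P.
  by move: s2; rewrite g0 subr0.
have P (s : R) : s \in `[h, 0] -> `|s| <= `|h|.
  rewrite in_itv/= => /andP[s0 sh]; rewrite !ler0_norm// ?lerN2//.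
  exact: ltW.
have wg : {within `[h, 0], continuous g}.
  by apply: continuous_in_subspaceT => s /[!inE] /P /cg.
have [s s1 s2] := @MVT_segment R g dg h 0 (ltW h0)
    (fun s hs => dgE s (P s (subset_itv_oo_cc hs))) wg.
exists s; first exact: P.
move: s2; rewrite g0 sub0r mulrN => e.
by rewrite -[RHS]opprK -[in RHS]e opprB.
Qed.

End plane.

(** * The maximum principle *)

Section maximum_principle.
Context {R : realType}.
Implicit Types (f g : 'rV[R]_2 -> R) (p q v x : 'rV[R]_2) (i j : 'I_2).
Implicit Types W : set 'rV[R]_2.

Lemma exists_lt_both (a b : R) : 0 < a -> 0 < b ->
  exists2 h, 0 < h & h < a /\ h < b.
Proof.
move=> a0 b0; have [ab|ba] := leP a b.
  by exists (a / 2); [lra|split; lra].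
by exists (b / 2); [lra|split; lra].
Qed.

Lemma ler_dist_half (e a b c : R) :
  `|a - c| < e / 2 -> `|c - b| < e / 2 -> `|a - b| <= e.
Proof.
move=> ac cb; rewrite (splitr e) (le_trans (ler_distD c _ _))//.
by rewrite lerD// ltW.
Qed.

Lemma mulI_sqr (h a b : R) : 0 < h -> a * h * h = b * h * h -> a = b.
Proof. by move=> h0 /mulIf + ; move=> /(_ (lt0r_neq0 h0)) /mulIf; apply; exact: lt0r_neq0. Qed.

Lemma subrACA (a b c d : R) : a - b - (c - d) = a - c - (b - d).
Proof. by ring. Qed.

Lemma near_normP (P : set 'rV[R]_2) q :
  (\forall x \near q, P x) <->
  exists2 r : R, 0 < r & forall x, `|x - q| < r -> P x.
Proof.
split=> [/nbhs_ballP[r /= r0 H]|[r r0 H]].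
  by exists r => // x xr; apply: H; rewrite -ball_normE /= distrC.
apply/nbhs_ballP; exists r => //= x; rewrite -ball_normE /= distrC.
exact: H.
Qed.

Lemma continuous_norm f q (e : R) : {for q, continuous f} -> 0 < e ->
  exists2 r : R, 0 < r & forall x, `|x - q| < r -> `|f q - f x| < e.
Proof.
by move=> cf e0; apply/near_normP; move/cvgrPdist_lt: cf; apply.
Qed.

Lemma near_line (P : set 'rV[R]_2) q v :
  (\forall x \near q, P x) -> \forall s \near (0 : R), P (q + s *: v).
Proof.
move=> nP; have : q + s *: v @[s --> (0 : R)] --> q.
  have : q + s *: v @[s --> (0 : R)] --> q + 0 *: v.
    by apply: cvgD; [exact: cvg_cst|apply: cvgZ; [exact: cvg_id|exact: cvg_cst]].
  by rewrite scale0r addr0.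
by apply.
Qed.

(** If [D] were positive, [dg] would be positive just to the right of 0, because it
vanishes at the maximum, and [g] would increase there. *)
Lemma second_derivative_test1 (g dg : R -> R) (r D : R) : 0 < r ->
  (forall s : R, `|s| < r -> is_derive s 1 g (dg s)) ->
  is_derive (0 : R) 1 dg D ->
  (forall s : R, `|s| < r -> g s <= g 0) -> D <= 0.
Proof.
move=> r0 dgE ddg gmax; rewrite leNgt; apply/negP => D0.
have r00 : `|0 : R| < r by rewrite normr0.
have dg0 : dg 0 = 0.
  have gmax0 : is_derive (0 : R) 1 g 0.
    apply: (@derive1_at_max R g (- r) r 0).
    - by rewrite lerNl (le_trans _ (ltW r0))// oppr_le0 ltW.
    - move=> t /[!in_itv]/= tr; apply: (@ex_derive _ _ _ _ _ _ (dg t)).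
      by apply: dgE; rewrite ltr_norml.
    - by rewrite in_itv/= oppr_lt0 r0.
    - by move=> t /[!in_itv]/= tr; apply: gmax; rewrite ltr_norml.
  have [_ E1] := dgE 0 r00.
  by have [_ E2] := gmax0; rewrite -E1 E2.
have [r' r'0 Hr'] : exists2 r' : R, 0 < r' & forall s, 0 < s -> s < r' -> 0 < dg s.
  have [d2 d2E] := ddg.
  have : s^-1 *: ((dg \o shift 0) (s *: (1 : R)) - dg 0) @[s --> (0 : R)^'] --> 'D_1 dg 0.
    exact: d2.
  rewrite d2E => /cvgr_gt /(_ _ D0) [r' /= r'0 H]; exists r' => // s s0 sr'.
  have := H s; rewrite /= dg0 subr0 addr0 [_%:A]mulr1 sub0r normrN gtr0_norm//.
  by rewrite /GRing.scale/= pmulr_rgt0 ?invr_gt0// gt_eqF//; apply.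
have [h h0 [hr hr']] := exists_lt_both r0 r'0.
have P (s : R) : 0 <= s <= h -> `|s| < r.
  by move=> /andP[s0 sh]; rewrite ger0_norm// (le_lt_trans sh).
have wg : {within `[0, h], continuous g}.
  apply: continuous_in_subspaceT => s /[!inE] /= /[!in_itv]/= /P /dgE [+ _].
  by move=> /derivable1_diffP /differentiable_continuous.
have [s] := @MVT R g dg 0 h h0 (fun s hs => dgE s (P s (subset_itv_oo_cc hs))) wg.
rewrite in_itv/= => /andP[s0 sh]; rewrite subr0 => E.
have := gmax h; rewrite (gtr0_norm h0) => /(_ hr).
rewrite leNgt -subr_gt0 E => /negP; apply; rewrite mulr_gt0//.
by apply: Hr' => //; exact: lt_trans sh _.
Qed.

Lemma second_derivative_test f q v :
  (\forall x \near q, derivable f x v) -> derivable ('D_v f) q v ->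
  (\forall x \near q, f x <= f q) -> 'D_v ('D_v f) q <= 0.
Proof.
move=> /(@near_line _ _ v) df d2f /(@near_line _ _ v) fmax.
have [r /= r0 Hr] : \forall s \near (0 : R), derivable f (q + s *: v) v /\ f (q + s *: v) <= f q.
  by near=> s; split; near: s.
have {}Hr (s : R) : `|s| < r -> derivable f (q + s *: v) v /\ f (q + s *: v) <= f q.
  by move=> sr; apply: Hr; rewrite /ball_/= sub0r normrN.
apply: (@second_derivative_test1 (fun s : R => f (q + s *: v))
  (fun s : R => 'D_v f (q + s *: v)) r).
- exact: r0.
- by move=> s /Hr[h _]; apply/is_derive_line; exact/derivableP.
- by apply/(@is_derive_line0 _ ('D_v f) q v); exact/derivableP.
- by move=> s /Hr[_]; rewrite scale0r addr0.
Unshelve. all: by end_near. Qed.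

(** If [f] is positive at [x0], the boundary hypothesis keeps the set
[[set x | W x /\ f x0 <= f x]] away from the boundary, so this set is compact; the
Laplacian of [f] would be positive at the maximum point of [f] on it. *)
Lemma max_principle W f : open W -> bounded_set W ->
  (forall x, W x -> {for x, continuous f}) ->
  (forall x i, W x -> derivable f x (delta_mx 0 i)) ->
  (forall x i, W x -> derivable (pderiv i f) x (delta_mx 0 i)) ->
  (forall x, W x -> 0 < f x -> 0 < laplacian f x) ->
  (forall q, closure W q -> ~ W q -> forall e, 0 < e ->
     \forall x \near q, W x -> f x < e) ->
  forall x, W x -> f x <= 0.
Proof.
move=> oW bW cf df d2f lf bf x0 Wx0; rewrite leNgt; apply/negP => fx0.
pose S := [set x | W x /\ f x0 <= f x].
have cS : compact S.
  apply: bounded_closed_compact.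
    by apply: (sub_boundedr _ bW) => A AW x [/AW].
  move=> q clS.
  have clW : closure W q by apply: closure_subset clS => x [].
  have [Wq|nWq] := pselect (W q).
    split=> //; rewrite leNgt; apply/negP => fq.
    have /clS [x [[_ h1] /= h2]] : \forall x \near q, f x < f x0.
      by move/cf: Wq => /cvgr_lt; exact.
    by move: h1; rewrite leNgt h2.
  have /clS [x [[Wx h1] /= h2]] := bf q clW nWq _ fx0.
  by move: h1; rewrite leNgt h2.
have [c cS' cmax] : exists2 c, c \in S & forall t, t \in S -> f t <= f c.
  apply: EVT_max_rV => //; first by exists x0; split.
  by apply: continuous_in_subspaceT => x /[!inE] -[/cf].
move: cS'; rewrite inE => -[Wc fc].
have nW : \forall x \near c, W x by apply: open_nbhs_nbhs.
have := lf c Wc (lt_le_trans fx0 fc); rewrite ltNge => /negP; apply.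
apply: sumr_le0 => i _; apply: second_derivative_test.
- by near=> x; apply: df; near: x.
- exact: d2f.
- near=> x; have Wx : W x by near: x.
  have [h|h] := leP (f x0) (f x); first by apply: cmax; rewrite inE.
  exact: ltW (lt_le_trans h fc).
Unshelve. all: by end_near. Qed.

(** The second difference of [f] over a square with side [h] is [h ^+ 2] times each
of the two mixed derivatives, taken at some point of the square; let the square
shrink to [q]. *)
Lemma pderivC f q i j :
  (\forall x \near q, derivable f x (delta_mx 0 i) /\ derivable f x (delta_mx 0 j)
     /\ derivable (pderiv i f) x (delta_mx 0 j)
     /\ derivable (pderiv j f) x (delta_mx 0 i)) ->
  {for q, continuous (pderiv i (pderiv j f))} ->
  {for q, continuous (pderiv j (pderiv i f))} ->
  pderiv i (pderiv j f) q = pderiv j (pderiv i f) q.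
Proof.
have square (k l : 'I_2) (r h : R) : 0 <= h -> 2 * h < r ->
    (forall x, `|x - q| < r -> derivable f x (delta_mx 0 k) /\ derivable (pderiv k f) x (delta_mx 0 l)) ->
    exists2 y, `|y - q| < r &
      f (q + h *: delta_mx 0 k + h *: delta_mx 0 l) - f (q + h *: delta_mx 0 l)
        - (f (q + h *: delta_mx 0 k) - f q) = pderiv l (pderiv k f) y * h * h.
  move=> h0 hr H.
  pose phi (x : 'rV[R]_2) := f (x + h *: delta_mx 0 l) - f x.
  have near1 (s t : R) : `|s| <= `|h| -> `|t| <= `|h| ->
     `|q + s *: delta_mx 0 k + t *: delta_mx 0 l - q| < r.
    move=> sh th; apply: le_lt_trans hr; rewrite mulrDl mul1r.
    have -> : q + s *: delta_mx 0 k + t *: delta_mx 0 l - q =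
      s *: delta_mx 0 k + t *: delta_mx 0 l by rewrite -[q + _ + _]addrA addrAC subrr add0r.
    rewrite (le_trans (ler_normD _ _))// !norm_scale_unit.
    by rewrite (ger0_norm h0) in sh th; rewrite lerD.
  have near0 (s : R) : `|s| <= `|h| -> `|q + s *: delta_mx 0 k - q| < r.
    move=> sh; have := near1 s 0 sh; rewrite scale0r addr0; apply.
    by rewrite normr0.
  have dphi (s : R) : `|s| <= `|h| -> is_derive (q + s *: delta_mx 0 k) (delta_mx 0 k) phi
     (pderiv k f (q + s *: delta_mx 0 k + h *: delta_mx 0 l) - pderiv k f (q + s *: delta_mx 0 k)).
    move=> sh; apply: is_deriveB; last first.
      by apply: derivableP; apply: (H _ _).1; exact: near0.
    have /derivableP := (H _ (near1 s h sh (lexx _))).1.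
    rewrite !is_derive_line0.
    congr (is_derive _ _ _ _); apply/funext => t /=; congr f.
    by rewrite addrAC.
  have [s sh E1] := @mvt_line R phi q (delta_mx 0 k) h (fun s sh => @ex_derive _ _ _ _ _ _ _ (dphi s sh)).
  have [t th E2] := @mvt_line R (pderiv k f) (q + s *: delta_mx 0 k) (delta_mx 0 l) h
     (fun t th => (H _ (near1 s t sh th)).2).
  exists (q + s *: delta_mx 0 k + t *: delta_mx 0 l); first exact: near1.
  have [_ D] := dphi s sh.
  move: E1; rewrite D E2 /phi /pderiv => <-; ring.
move=> /near_normP [r r0 H] ci cj.
apply/eqP; rewrite -subr_eq0 -normr_le0; apply/ler_addgt0Pl => e e0; rewrite addr0.
have e2 : 0 < e / 2 by rewrite divr_gt0.
have [r1 r10 H1] := continuous_norm ci e2.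
have [r2 r20 H2] := continuous_norm cj e2.
have [r3 r30 [r31 r32]] := exists_lt_both r10 r20.
have [r' r'0 [r'r /ltW r'3]] := exists_lt_both r0 r30.
have r'1 : r' <= r1 by exact: le_trans (ltW r31).
have r'2 : r' <= r2 by exact: le_trans (ltW r32).
have [h h0 hr] : exists2 h : R, 0 < h & 2 * h < r'.
  by clear -r'0; exists (r' / 3); lra.
have [|y yr Ey] := square i j r' h (ltW h0) hr.
  move=> x /lt_le_trans xr; split; first by apply: (H _ _).1; apply: xr; exact: ltW.
  by apply: (H _ _).2.2.1; apply: xr; exact: ltW.
have [|z zr Ez] := square j i r' h (ltW h0) hr.
  move=> x /lt_le_trans xr; split; first by apply: (H _ _).2.1; apply: xr; exact: ltW.
  by apply: (H _ _).2.2.2; apply: xr; exact: ltW.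
have E : pderiv i (pderiv j f) z * h * h = pderiv j (pderiv i f) y * h * h.
  by rewrite -[LHS]Ez -[RHS]Ey (addrAC q (h *: delta_mx 0 j)) subrACA.
have z1 : `|pderiv i (pderiv j f) q - pderiv i (pderiv j f) z| < e / 2.
  apply: H1; exact: lt_le_trans zr _.
have y1 : `|pderiv j (pderiv i f) q - pderiv j (pderiv i f) y| < e / 2.
  apply: H2; exact: lt_le_trans yr _.
rewrite (mulI_sqr h0 E) in z1; rewrite distrC in y1.
exact: (ler_dist_half z1 y1).
Qed.

End maximum_principle.

(** * An interior gradient estimate for the Laplacian *)

Section gradient_estimate.
Context {R : realType}.
Implicit Types (f g v : 'rV[R]_2 -> R) (p q x y : 'rV[R]_2) (i j : 'I_2).

#[local] Existing Instance is_derive_coord.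

Lemma ord2P i : i = 0 \/ i = 1.
Proof. by case: i => -[|[|//]] h; [left|right]; apply/val_inj. Qed.

Lemma big_ord2 (F : 'I_2 -> R) : \sum_(i < 2) F i = F 0 + F 1.
Proof.
rewrite big_ord_recl big_ord_recl big_ord0 addr0.
by have -> : lift ord0 ord0 = 1 :> 'I_2 by apply/val_inj.
Qed.

Lemma laplacianE f x :
  laplacian f x = pderiv 0 (pderiv 0 f) x + pderiv 1 (pderiv 1 f) x.
Proof. exact: big_ord2. Qed.

(** How second derivatives are computed below: from a formula for the first one that
holds near [x]. *)
Lemma is_derive_pderiv f (D1 : 'rV[R]_2 -> R) (D2 : R) x i j :
  (\forall y \near x, is_derive y (delta_mx 0 i) f (D1 y)) ->
  is_derive x (delta_mx 0 j) D1 D2 ->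
  is_derive x (delta_mx 0 j) (pderiv i f) D2.
Proof.
move=> n1; apply: near_eq_is_derive; apply: filterS n1 => y [_ <-].
by [].
Qed.

Definition reflect p i x := x - (2 * (x 0 i - p 0 i)) *: delta_mx 0 i.

Lemma reflect_coord p i x j :
  (reflect p i x - p) 0 j = (-1) ^+ (i == j) * (x - p) 0 j.
Proof.
rewrite !mxE eqxx /= [j == i]eq_sym; case: eqP => [->|_]; rewrite /=.
  by rewrite expr1; ring.
by rewrite expr0; ring.
Qed.

Lemma norm_reflect p i x (d : R) : 0 <= d -> `|x - p| <= d ->
  `|reflect p i x - p| <= d.
Proof.
move=> d0 xd; apply: norm_le_coord => // j; rewrite reflect_coord.
by rewrite normrM normrX normrN1 expr1n mul1r (le_trans (coord_le_norm _ _)).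
Qed.

Lemma reflect_id p i x : x 0 i = p 0 i -> reflect p i x = x.
Proof. by move=> e; rewrite /reflect e subrr mulr0 scale0r subr0. Qed.

Lemma continuous_reflect p i : continuous (reflect p i).
Proof.
move=> x.
(* An abstract filter [F]: the neighbourhoods of a matrix unfold, which hides that
   they form a filter. The later continuity proofs do the same. *)
have key (F : set_system 'rV[R]_2) : Filter F -> y @[y --> F] --> x ->
    reflect p i y @[y --> F] --> reflect p i x.
  move=> FF Fx; apply: cvgB; first exact: Fx.
  apply: cvgZ; last exact: cvg_cst.
  apply: cvgM; first exact: cvg_cst.
  apply: cvgB; last exact: cvg_cst.
  exact: (cvg_comp _ _ Fx (@continuous_coord R i x)).
exact: (key (nbhs x) _ (@cvg_id _ _)).
Qed.

Lemma is_derive_reflect p i j f x (df : R) :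
  is_derive (reflect p i x) (delta_mx 0 j) f df ->
  is_derive x (delta_mx 0 j) (fun y => f (reflect p i y)) ((-1) ^+ (i == j) * df).
Proof.
move=> /is_derive_line0 h; apply/is_derive_line0.
set a : R := (-1) ^+ _.
have -> : (fun s : R => f (reflect p i (x + s *: delta_mx 0 j))) =
    (fun s : R => f (reflect p i x + s *: delta_mx 0 j)) \o (fun s : R => a * s).
  apply/funext => s /=; congr f; apply/rowP => k.
  rewrite !mxE eqxx /= /a [k == i]eq_sym [k == j]eq_sym.
  case: (i =P j) => [->|ij].
    by case: (j =P k) => _; rewrite ?expr1 ?expr0/=; ring.
  case: (i =P k) => [ik|_] /=; last by rewrite expr0; ring.
  have -> : (j == k) = false by apply/eqP => jk; apply: ij; rewrite ik jk.
  by rewrite /= expr0; ring.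
rewrite mulrC; apply: is_derive1_comp; first by rewrite mulr0.
by apply: is_derive_eq; rewrite /GRing.scale/=; ring.
Qed.

End gradient_estimate.

Section gradient_estimate.
Context {R : realType}.
Implicit Types (f g v : 'rV[R]_2 -> R) (p q x y : 'rV[R]_2) (i j : 'I_2).

#[local] Existing Instance is_derive_coord.

(** On the half square [0 < x 0 i - p 0 i < d], the barrier with [A = M / d ^+ 2]
dominates [M] on the three sides off the line [x 0 i = p 0 i], vanishes at [p],
and has Laplacian [- 2 * B]. *)
Definition barrier p i (A B d : R) : 'rV[R]_2 -> R := fun x =>
  A * ((x 0 0 - p 0 0) ^+ 2 + (x 0 1 - p 0 1) ^+ 2
       + 2 * ((x 0 i - p 0 i) * (d - (x 0 i - p 0 i))))
  + B * ((x 0 i - p 0 i) * (d - (x 0 i - p 0 i))).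

Definition barrier1 p i (A B d : R) j : 'rV[R]_2 -> R := fun x =>
  2 * A * (x 0 j - p 0 j)
  + (i == j)%:R * ((2 * A + B) * (d - 2 * (x 0 i - p 0 i))).

Lemma is_derive_barrier p i A B d j x :
  is_derive x (delta_mx 0 j) (barrier p i A B d) (barrier1 p i A B d j x).
Proof.
apply: is_derive_eq; rewrite /GRing.scale/= /barrier1 !mxE !eqxx /=.
by case: (ord2P i) => ->; case: (ord2P j) => -> /=; ring.
Qed.

Lemma is_derive_barrier1 p i A B d j x :
  is_derive x (delta_mx 0 j) (barrier1 p i A B d j)
    (2 * A - (i == j)%:R * (4 * A + 2 * B)).
Proof.
apply: is_derive_eq; rewrite /GRing.scale/= !mxE !eqxx /=.
by case: (ord2P i) => ->; case: (ord2P j) => -> /=; ring.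
Qed.

Lemma continuous_barrier p i A B d : continuous (barrier p i A B d).
Proof.
move=> x.
have key (F : set_system 'rV[R]_2) : Filter F -> y @[y --> F] --> x ->
    barrier p i A B d y @[y --> F] --> barrier p i A B d x.
  move=> FF Fx.
  have cj j : y 0 j - p 0 j @[y --> F] --> x 0 j - p 0 j.
    apply: cvgB; last exact: cvg_cst.
    exact: (cvg_comp _ _ Fx (@continuous_coord R j x)).
  have ci : (y 0 i - p 0 i) * (d - (y 0 i - p 0 i)) @[y --> F] -->
      (x 0 i - p 0 i) * (d - (x 0 i - p 0 i)).
    by apply: cvgM; [exact: cj|apply: cvgB; [exact: cvg_cst|exact: cj]].
  apply: cvgD; last by apply: cvgM; [exact: cvg_cst|exact: ci].
  apply: cvgM; first exact: cvg_cst.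
  apply: cvgD; last by apply: cvgM; [exact: cvg_cst|exact: ci].
  by apply: cvgD; (apply: cvgM; exact: cj).
exact: (key (nbhs x) _ (@cvg_id _ _)).
Qed.

Lemma barrier_ge_edge (X Y d M B : R) : 0 < d -> 0 <= M -> 0 <= B -> 0 <= X <= d ->
  X = d \/ `|Y| = d ->
  M <= M / d ^+ 2 * (X ^+ 2 + Y ^+ 2 + 2 * (X * (d - X))) + B * (X * (d - X)).
Proof.
move=> d0 M0 B0 /andP[X0 Xd] XY.
have h1 : 0 <= X * (d - X) by rewrite mulr_ge0// subr_ge0.
have h2 : 0 <= B * (X * (d - X)) by rewrite mulr_ge0.
suff : d ^+ 2 <= X ^+ 2 + Y ^+ 2 + 2 * (X * (d - X)).
  move=> h; rewrite -[leLHS]addr0 lerD//.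
  have dn0 : d ^+ 2 != 0 by rewrite expf_neq0// gt_eqF.
  rewrite -[leLHS](divfK dn0) ler_wpM2l// divr_ge0// exprn_ge0//.
  exact: ltW.
case: XY => [->|Yd]; first by rewrite subrr !mulr0 addr0 lerDl sqr_ge0.
have -> : d ^+ 2 = Y ^+ 2 by rewrite -Yd real_normK ?num_real.
rewrite -addrA addrCA lerDl.
by rewrite addr_ge0 ?sqr_ge0// mulr_ge0.
Qed.

(** Half of [v] minus its reflection vanishes on the line of reflection, is bounded
by [M], and has a Laplacian smaller than [N] in absolute value. Minus the barrier,
it is nonpositive on the sides of the half square and has positive Laplacian, so
the maximum principle applies. *)
Lemma reflection_le_barrier v p i (d M N : R) : 0 < d ->
  (forall x, `|x - p| <= d -> [/\ {for x, continuous v},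
     forall j, derivable v x (delta_mx 0 j),
     forall j, derivable (pderiv j v) x (delta_mx 0 j),
     `|v x| <= M & `|laplacian v x| < N]) ->
  forall x, `|x - p| < d -> 0 < x 0 i - p 0 i ->
    2^-1 * (v x - v (reflect p i x)) <= barrier p i (M / d ^+ 2) (N / 2) d x.
Proof.
move=> d0 H x xd x0.
have pd : `|p - p| <= d by rewrite subrr normr0 ltW.
have M0 : 0 <= M by have [_ _ _ + _] := H p pd; apply: le_trans.
have N0 : 0 <= N by have [_ _ _ _ h] := H p pd; apply: ltW; apply: le_lt_trans h.
have rd y : `|y - p| <= d -> `|reflect p i y - p| <= d.
  exact: norm_reflect (ltW d0).
pose psi := barrier p i (M / d ^+ 2) (N / 2) d.
pose f := fun x : 'rV[R]_2 => 2^-1 * (v x - v (reflect p i x)) - psi x.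
pose f1 j := fun x : 'rV[R]_2 => 2^-1 * (pderiv j v x - (-1) ^+ (i == j) * pderiv j v (reflect p i x))
    - barrier1 p i (M / d ^+ 2) (N / 2) d j x.
pose f2 j x := 2^-1 * (pderiv j (pderiv j v) x - pderiv j (pderiv j v) (reflect p i x))
    - (2 * (M / d ^+ 2) - (i == j)%:R * (4 * (M / d ^+ 2) + 2 * (N / 2))).
have df j y : `|y - p| <= d -> is_derive y (delta_mx 0 j) f (f1 j y).
  move=> yd; apply: is_deriveB; last exact: is_derive_barrier.
  apply: is_deriveZ; apply: is_deriveB.
    by have [_ + _ _ _] := H y yd; move=> /(_ j) /derivableP.
  apply: is_derive_reflect.
  by have [_ + _ _ _] := H _ (rd y yd); move=> /(_ j) /derivableP.
have nd y : `|y - p| < d -> \forall z \near y, `|z - p| <= d.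
  move=> yd; apply/near_normP; exists (d - `|y - p|); first by rewrite subr_gt0.
  move=> z; rewrite ltrBrDr => /ltW; apply: le_trans.
  have -> : z - p = (z - y) + (y - p) by rewrite addrA subrK.
  exact: ler_normD.
have d2f j y : `|y - p| < d -> is_derive y (delta_mx 0 j) (pderiv j f) (f2 j y).
  move=> yd; have yd' := ltW yd.
  apply: (@is_derive_pderiv _ f (f1 j)).
    by apply: filterS (nd y yd) => z /df.
  apply: is_deriveB; last exact: is_derive_barrier1.
  apply: is_deriveZ; apply: is_deriveB.
    by have [_ _ + _ _] := H y yd'; move=> /(_ j) /derivableP.
  set D := (X in is_derive _ _ _ X).
  have -> : D = (-1) ^+ (i == j) * ((-1) ^+ (i == j) * D).
    by rewrite mulrA -expr2 sqrr_sign mul1r.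
  apply: (@is_deriveZ _ _ _ (fun z => pderiv j v (reflect p i z)) ((-1) ^+ (i == j))).
  apply: is_derive_reflect.
  by have [_ _ + _ _] := H _ (rd y yd'); move=> /(_ j) /derivableP.
have cf y : `|y - p| <= d -> {for y, continuous f}.
  move=> yd; have [cy _ _ _ _] := H y yd.
  have [cry _ _ _ _] := H _ (rd y yd).
  have key (F : set_system 'rV[R]_2) : Filter F -> z @[z --> F] --> y ->
     v z @[z --> F] --> v y -> v (reflect p i z) @[z --> F] --> v (reflect p i y) ->
     psi z @[z --> F] --> psi y -> f z @[z --> F] --> f y.
    move=> FF F1 F2 F3 F4; apply: cvgB; last exact: F4.
    by apply: cvgM; [exact: cvg_cst|apply: cvgB].
  apply: (key (nbhs y)) => //; last exact: continuous_barrier.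
  exact: (cvg_comp _ _ (@continuous_reflect R p i y) cry).
pose W := [set y | `|y - p| < d /\ 0 < y 0 i - p 0 i].
have ci y : {for y, continuous (fun y : 'rV[R]_2 => y 0 i - p 0 i)}.
  have key (F : set_system 'rV[R]_2) : Filter F -> z 0 i @[z --> F] --> y 0 i ->
      z 0 i - p 0 i @[z --> F] --> y 0 i - p 0 i.
    by move=> FF F1; apply: cvgB; [|exact: cvg_cst].
  exact: (key (nbhs y) _ (@continuous_coord R i y)).
have cn y : {for y, continuous (fun y : 'rV[R]_2 => `|y - p|)}.
  have key (F : set_system 'rV[R]_2) : Filter F -> z @[z --> F] --> y ->
      `|z - p| @[z --> F] --> `|y - p|.
    by move=> FF F1; apply: cvg_norm; apply: cvgB; [|exact: cvg_cst].
  exact: (key (nbhs y) _ (@cvg_id _ _)).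
have clW q : closure W q -> `|q - p| <= d /\ 0 <= q 0 i - p 0 i.
  move=> cl; split; rewrite leNgt; apply/negP => h.
    have /cl [z [[h1 _] /=]] : \forall z \near q, d < `|z - p|.
      by move/cvgr_gt: (cn q); apply.
    by move/lt_trans/(_ h1); rewrite ltxx.
  have /cl [z [[_ h1] /=]] : \forall z \near q, (z : 'rV[R]_2) 0 i - p 0 i < 0.
    by move/cvgr_lt: (ci q); apply.
  by move=> /(lt_trans h1); rewrite ltxx.
have fle0 : f x <= 0.
  apply: (@max_principle R W f) => //.
  - rewrite openE => y [h1 h2] /=; apply: filterI.
      by move/cvgr_lt: (cn y); apply.
    by move/cvgr_gt: (ci y); apply.
  - exists (`|p| + d); split; first exact: num_real.
    move=> K hK y [yd _].
    apply: le_trans (ltW hK); rewrite -(subrK p y) addrC.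
    by rewrite (le_trans (ler_normD _ _))// lerD2l ltW.
  - by move=> y [yd _]; apply: cf; exact: ltW.
  - by move=> y j [yd _]; case: (df j y (ltW yd)).
  - by move=> y j [yd _]; case: (d2f j y yd).
  - move=> y [yd _] _; rewrite laplacianE.
    have [_ E0] := d2f 0 y yd; have [_ E1] := d2f 1 y yd.
    rewrite {1}/pderiv E0 {1}/pderiv E1 /f2.
    have [_ _ _ _] := H y (ltW yd); have [_ _ _ _] := H _ (rd y (ltW yd)).
    rewrite !laplacianE.
    move: (pderiv 0 (pderiv 0 v) y) (pderiv 1 (pderiv 1 v) y)
      (pderiv 0 (pderiv 0 v) (reflect p i y)) (pderiv 1 (pderiv 1 v) (reflect p i y))
      (M / d ^+ 2) => a b a' b' K.
    rewrite !ltr_norml => /andP[h1 h2] /andP[h3 h4].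
    by clear -h1 h2 h3 h4; case: (ord2P i) => -> /=; lra.
  - move=> q /clW [qd q0] nWq e e0.
    (* Either [q] is on the line of reflection, where [v] cancels its reflection, or
       it is on one of the three other sides, where the barrier is at least [M]. *)
    have fq : f q <= 0.
      have [q0'|q0'] := eqVneq (q 0 i) (p 0 i).
        rewrite /f reflect_id// subrr mulr0 sub0r oppr_le0.
        rewrite /psi /barrier q0' subrr mul0r !mulr0 !addr0.
        by rewrite mulr_ge0 ?divr_ge0 ?exprn_ge0 ?addr_ge0 ?sqr_ge0// ltW.
      have q0'' : 0 < q 0 i - p 0 i by rewrite lt0r q0 andbT subr_eq0.
      have qi : q 0 i - p 0 i <= d.
        apply: le_trans qd; apply: le_trans (coord_le_norm _ i).
        by rewrite !mxE ler_norm.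
      have [_ _ _ v1 _] := H q qd; have [_ _ _ v2 _] := H _ (rd q qd).
      have psiM : M <= psi q.
        have : exists j, `|q 0 j - p 0 j| = d.
          apply: contrapT => /forallNP hj; apply: nWq; split => //.
          apply: norm_lt_coord => // j; rewrite lt_neqAle; apply/andP; split.
            by apply/eqP; have := hj j; rewrite !mxE.
          exact: le_trans (coord_le_norm _ _) qd.
        move=> [j hj]; rewrite /psi /barrier.
        have B0 : 0 <= N / 2 by rewrite divr_ge0.
        have X01 : 0 <= q 0 i - p 0 i <= d by rewrite q0.
        case: (ord2P i) => ei; rewrite ei in X01 *.
          apply: (@barrier_ge_edge (q 0 0 - p 0 0) (q 0 1 - p 0 1)) => //.
          case: (ord2P j) => ej; rewrite ej in hj; last by right.
          by left; rewrite -hj ger0_norm//; case/andP: X01.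
        rewrite [(q 0 0 - p 0 0) ^+ 2 + _]addrC.
        apply: (@barrier_ge_edge (q 0 1 - p 0 1) (q 0 0 - p 0 0)) => //.
        case: (ord2P j) => ej; rewrite ej in hj; first by right.
        by left; rewrite -hj ger0_norm//; case/andP: X01.
      rewrite /f subr_le0 (le_trans _ psiM)//.
      move: v1 v2; rewrite !ler_norml => /andP[v1 v1'] /andP[v2 v2'].
      by clear -v1 v1' v2 v2'; lra.
    have : \forall z \near q, f z < e.
      by move/cvgr_lt: (cf q qd); apply; exact: le_lt_trans fq e0.
    by apply: filterS => z.
by rewrite -subr_le0.
Qed.

End gradient_estimate.

Section gradient_estimate_conclusion.
Context {R : realType}.
Implicit Types (f g v : 'rV[R]_2 -> R) (p q x y : 'rV[R]_2) (i j : 'I_2).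

Lemma near_ball p y (r : R) : `|y - p| < r -> \forall z \near y, `|z - p| < r.
Proof.
move=> yd; apply/near_normP; exists (r - `|y - p|); first by rewrite subr_gt0.
move=> z; rewrite ltrBrDr; apply: le_lt_trans.
have -> : z - p = (z - y) + (y - p) by rewrite addrA subrK.
exact: ler_normD.
Qed.

Lemma derive_le_slope (h : R -> R) (D C d : R) : 0 < d ->
  is_derive (0 : R) 1 h D -> h 0 = 0 ->
  (forall t, 0 < t -> t < d -> h t <= t * C) -> D <= C.
Proof.
move=> d0 [d1 d2] h0 hC; rewrite leNgt; apply/negP => CD.
have : s^-1 *: ((h \o shift 0) (s *: (1 : R)) - h 0) @[s --> (0 : R)^'] --> 'D_1 h 0.
  exact: d1.
rewrite d2 => /cvgr_gt /(_ _ CD) [r /= r0 H].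
have [t t0 [td tr]] := exists_lt_both d0 r0.
have := H t; rewrite /= h0 subr0 addr0 [_%:A]mulr1 sub0r normrN gtr0_norm//.
move=> /(_ tr (lt0r_neq0 t0)); rewrite /GRing.scale/= ltNge => /negP; apply.
by rewrite ler_pdivrMl// hC.
Qed.

Definition twice_derivable f x := forall j,
  derivable f x (delta_mx 0 j) /\ derivable (pderiv j f) x (delta_mx 0 j).

(** Both sides of [reflection_le_barrier] vanish at [p]: compare their slopes in the
direction of the reflection. *)
Lemma pderiv_le v p i (d M N : R) : 0 < d ->
  (forall x, `|x - p| <= d -> [/\ {for x, continuous v}, twice_derivable v x,
     `|v x| <= M & `|laplacian v x| < N]) ->
  pderiv i v p <= 2 * M / d + N * d / 2.
Proof.
move=> d0 H.
have pd : `|p - p| <= d by rewrite subrr normr0 ltW.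
have M0 : 0 <= M by have [_ _ + _] := H p pd; apply: le_trans.
have N0 : 0 <= N by have [_ _ _ h] := H p pd; apply: ltW; apply: le_lt_trans h.
have [_ /(_ i) [/derivableP dv _] _ _] := H p pd.
pose h x := 2^-1 * (v x - v (reflect p i x)).
have rp : reflect p i p = p by exact: reflect_id.
have dh : is_derive p (delta_mx 0 i) h (2^-1 * (pderiv i v p - (-1) ^+ (i == i) * pderiv i v p)).
  rewrite /h; apply: is_deriveZ; apply: is_deriveB.
  by apply: is_derive_reflect; rewrite rp; exact: dv.
have -> : pderiv i v p = 2^-1 * (pderiv i v p - (-1) ^+ (i == i) * pderiv i v p).
  by rewrite eqxx expr1; move: (pderiv _ _ _) => a; clear; lra.
move/is_derive_line0 : dh => dh; apply: (derive_le_slope d0 dh).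
  by rewrite scale0r addr0 /h rp subrr mulr0.
move=> t t0 td.
have E k : (p + t *: delta_mx 0 i) 0 k - p 0 k = t * (i == k)%:R.
  by rewrite !mxE eqxx [k == i]eq_sym /=; ring.
apply: (@le_trans _ _ (barrier p i (M / d ^+ 2) (N / 2) d (p + t *: delta_mx 0 i))).
  apply: reflection_le_barrier => //.
  - move=> x /H [h1 h2 h3 h4]; split => // j; first by case: (h2 j).
    by case: (h2 j).
  - by rewrite addrC addKr norm_scale_unit gtr0_norm.
  - by rewrite E eqxx mulr1.
have -> : barrier p i (M / d ^+ 2) (N / 2) d (p + t *: delta_mx 0 i) =
    M / d ^+ 2 * (2 * t * d - t ^+ 2) + N / 2 * (t * (d - t)).
  by rewrite /barrier !E; case: (ord2P i) => -> /=; ring.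
have -> : t * (2 * M / d + N * d / 2) = M / d ^+ 2 * (2 * t * d) + N / 2 * (t * d).
  by field; rewrite gt_eqF.
rewrite lerD//.
  by rewrite ler_wpM2l ?divr_ge0 ?exprn_ge0 ?(ltW d0)// lerBlDr lerDl sqr_ge0.
by rewrite ler_wpM2l ?divr_ge0// ler_pM2l// lerBlDr lerDl ltW.
Qed.

Lemma laplacian_opp v x : (\forall y \near x, twice_derivable v y) ->
  twice_derivable (fun y => - v y) x /\
  laplacian (fun y => - v y) x = - laplacian v x.
Proof.
move=> n2.
have key k : is_derive x (delta_mx 0 k) (pderiv k (fun y => - v y))
    (- pderiv k (pderiv k v) x).
  apply: (@is_derive_pderiv _ _ (fun y => - pderiv k v y)).
    by apply: filterS n2 => y /(_ k) [/derivableP h _]; apply: is_deriveN h.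
  apply: is_deriveN; apply: derivableP.
  by have /(_ k) [] := nbhs_singleton n2.
split.
  move=> k; split; last by case: (key k).
  by have /(_ k) [h _] := nbhs_singleton n2; apply: derivableN.
have E k : pderiv k (pderiv k (fun y => - v y)) x = - pderiv k (pderiv k v) x.
  by case: (key k).
by rewrite !laplacianE !E opprD.
Qed.

(** The bound does not involve the derivatives of the Laplacian, so it applies to
differences of solutions of a nonlinear equation. *)
Lemma gradient_estimate v p i (r d M N : R) : 0 < d -> d < r ->
  (forall x, `|x - p| < r -> [/\ {for x, continuous v}, twice_derivable v x,
     `|v x| <= M & `|laplacian v x| < N]) ->
  `|pderiv i v p| <= 2 * M / d + N * d / 2.
Proof.
move=> d0 dr H.
have H' x : `|x - p| <= d -> [/\ {for x, continuous v}, twice_derivable v x,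
     `|v x| <= M & `|laplacian v x| < N].
  by move=> xd; apply: H; exact: le_lt_trans dr.
have n2 x : `|x - p| <= d -> \forall y \near x, twice_derivable v y.
  move=> xd; have := near_ball (le_lt_trans xd dr).
  by apply: filterS => y /H [].
have pd : `|p - p| <= d by rewrite subrr normr0 ltW.
rewrite ler_norml; apply/andP; split; last exact: pderiv_le.
rewrite lerNl.
have -> : - pderiv i v p = pderiv i (fun y => - v y) p.
  have /(_ i) [/derivableP h _] := nbhs_singleton (n2 p pd).
  by have [_ E] := is_deriveN h; rewrite /pderiv -E.
apply: pderiv_le; first exact: d0.
move=> x xd.
have [h1 h2 h3 h4] := H' x xd.
have [h5 h6] := laplacian_opp (n2 x xd).
split.
- exact: continuousN h1.
- exact: h5.
- by rewrite normrN.
- by rewrite h6 normrN.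
Qed.

End gradient_estimate_conclusion.

(** * Continuous convergence *)

Section continuous_convergence.
Context {R : realType}.
Implicit Types (f g : nat -> 'rV[R]_2 -> R) (F G H : 'rV[R]_2 -> R).
Implicit Types (p x y : 'rV[R]_2) (i j : 'I_2) (W : set 'rV[R]_2).
Implicit Types Wn : nat -> set 'rV[R]_2.

(** The product of [\oo] and the neighbourhoods of [p], given by its generators.
Convergence of [f n x] to [F p] along this filter at every [p] (continuous
convergence) is locally uniform convergence to a continuous limit, and it
inherits limits of sums, products and compositions from filters. *)
Definition seqnbhs p : set_system (nat * 'rV[R]_2) :=
  [set P | exists2 r : R, 0 < r & exists N : nat,
     forall n x, (N <= n)%N -> `|x - p| < r -> P (n, x)].

#[global] Instance seqnbhs_filter p : ProperFilter (seqnbhs p).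
Proof.
apply: Build_ProperFilter_ex.
  move=> P [r r0 [N H]]; exists (N, p); apply: H => //.
  by rewrite subrr normr0.
split.
- by exists 1 => //; exists 0%N.
- move=> P Q [r r0 [N HP]] [s s0 [M HQ]].
  have [t t0 [tr ts]] := exists_lt_both r0 s0.
  exists t => //; exists (maxn N M) => n x; rewrite geq_max => /andP[Nn Mn] xt; split.
    by apply: HP => //; exact: lt_trans tr.
  by apply: HQ => //; exact: lt_trans ts.
- move=> P Q PQ [r r0 [N HP]]; exists r => //; exists N => n x Nn xr.
  exact/PQ/HP.
Qed.

Definition ccvg W f F := forall p, W p ->
  f nx.1 nx.2 @[nx --> seqnbhs p] --> F p.

(** In this form the exhaustion says that a property of [f n] on [Wn n] holds
along [seqnbhs p] for each [p] in [W]. *)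
Definition exhausted_by Wn W :=
  (forall n, Wn n `<=` W) /\ forall p, W p -> seqnbhs p [set nx | Wn nx.1 nx.2].

Lemma ccvgP W f F : ccvg W f F <-> forall p, W p -> forall e : R, 0 < e ->
  exists2 r : R, 0 < r & exists N : nat,
     forall n x, (N <= n)%N -> `|x - p| < r -> `|F p - f n x| < e.
Proof.
by split=> [h p Wp e e0|h p Wp]; [exact: ((cvgrPdist_lt _ _).1 (h p Wp) e e0)|
  apply/cvgrPdist_lt => e e0; exact: h].
Qed.

Lemma ccvg_pointwise W f F p : ccvg W f F -> W p -> f ^~ p @ \oo --> F p.
Proof.
move=> /ccvgP cF Wp; apply/cvgrPdist_lt => e e0.
have [r r0 [N H]] := cF p Wp e e0.
by exists N => // n /= Nn; apply: H => //; rewrite subrr normr0.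
Qed.

Lemma ccvg_ext Wn W f g F G : exhausted_by Wn W ->
  (forall n x, Wn n x -> f n x = g n x) -> (forall x, W x -> F x = G x) ->
  ccvg W f F -> ccvg W g G.
Proof.
move=> [_ ex] fg FG cf p Wp; rewrite -FG//.
apply: cvg_trans (cf p Wp); apply: near_eq_cvg.
by apply: filterS (ex p Wp) => -[n x] /= /fg ->.
Qed.

Lemma exhausted_nbhs Wn W p : exhausted_by Wn W -> W p ->
  exists2 r : R, 0 < r & exists N : nat,
     forall n x, (N <= n)%N -> `|x - p| < r -> Wn n x /\ W x.
Proof.
move=> [sub ex] /ex [r r0 [N H]]; exists r => //; exists N => n x Nn xr.
have Wnx := H n x Nn xr.
split; first exact: Wnx.
exact: sub Wnx.
Qed.

Lemma cvg_norm_le (a : nat -> R) (l b c : R) N : a @ \oo --> l ->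
  (forall n, (N <= n)%N -> `|a n - b| <= c) -> `|l - b| <= c.
Proof.
move=> al ab.
have : `|a n - b| @[n --> \oo] --> `|l - b|.
  by apply: cvg_norm; apply: cvgB; [exact: al|exact: cvg_cst].
move=> /cvgr_to_le; apply; exists N => // n /= Nn; exact: ab.
Qed.

Lemma norm_continuous F p :
  (forall e : R, 0 < e -> exists2 r : R, 0 < r &
     forall x, `|x - p| < r -> `|F p - F x| <= e) -> {for p, continuous F}.
Proof.
move=> H.
have key (Fl : set_system 'rV[R]_2) : Filter Fl ->
    (forall e : R, 0 < e -> \forall x \near Fl, `|F p - F x| <= e) ->
    F x @[x --> Fl] --> F p.
  by move=> FF h; apply/cvgrPdist_le.
apply: (key (nbhs p)) => e e0; have [r r0 h] := H e e0.
by apply/near_normP; exists r.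
Qed.

Lemma ccvg_continuous Wn W f F p : exhausted_by Wn W -> ccvg W f F -> W p ->
  {for p, continuous F}.
Proof.
move=> ex cF Wp; apply: norm_continuous => e e0.
have [r r0 [N H]] := exhausted_nbhs ex Wp.
have [s s0 [M K]] := (ccvgP W f F).1 cF p Wp e e0.
have [t t0 [tr ts]] := exists_lt_both r0 s0.
exists t; first exact: t0.
move=> x xt.
have Wx := (H N x (leqnn N) (lt_trans xt tr)).2.
rewrite distrC.
apply: (cvg_norm_le (N := M) (ccvg_pointwise cF Wx)) => n Mn.
by rewrite distrC ltW// K//; exact: lt_trans ts.
Qed.

(** By the mean value theorem the difference quotients of [f n] at [p] are values of
its derivative near [p], hence within [e] of [G p] uniformly in [n]. *)
Lemma ccvg_derive Wn W f F G i p : exhausted_by Wn W -> ccvg W f F ->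
  (forall n x, Wn n x -> derivable (f n) x (delta_mx 0 i)) ->
  ccvg W (fun n => pderiv i (f n)) G -> W p ->
  is_derive p (delta_mx 0 i) F (G p).
Proof.
move=> ex cF df cG Wp.
suff : h^-1 *: ((F \o shift p) (h *: delta_mx 0 i) - F p) @[h --> (0 : R)^'] --> G p.
  move=> h; split; last exact: cvg_lim h.
  by apply/cvg_ex; exists (G p).
apply/cvgrPdist_le => e e0.
have [r r0 [N H]] := exhausted_nbhs ex Wp.
have [s s0 [M K]] := (ccvgP W _ G).1 cG p Wp e e0.
have [t t0 [tr ts]] := exists_lt_both r0 s0.
exists t => // h /=; rewrite sub0r normrN => ht h0.
have pt (k : R) : `|k| <= `|h| -> `|p + k *: delta_mx 0 i - p| < t.
  by move=> kh; rewrite addrC addKr norm_scale_unit (le_lt_trans kh).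
have key : `|(F (p + h *: delta_mx 0 i) - F p) - h * G p| <= `|h| * e.
  have WpH := (H N _ (leqnn N) (lt_trans (pt h (lexx _)) tr)).2.
  have : f n (p + h *: delta_mx 0 i) - f n p @[n --> \oo] -->
      F (p + h *: delta_mx 0 i) - F p.
    by apply: cvgB; exact: ccvg_pointwise cF _.
  move=> /(@cvg_norm_le _ _ _ _ (maxn N M)); apply.
  move=> n; rewrite geq_max => /andP[Nn Mn].
  have [k kh ->] := @mvt_line R (f n) p (delta_mx 0 i) h
    (fun k kh => df n _ (H n _ Nn (lt_trans (pt k kh) tr)).1).
  rewrite mulrC -mulrBr normrM ler_wpM2l// distrC ltW//.
  exact: K Mn (lt_trans (pt k kh) ts).
have fin (A B : R) : `|A - h * B| <= `|h| * e -> `|B - h^-1 * A| <= e.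
  move=> hA; rewrite -[B](mulKf h0) -mulrBr normrM normfV.
  by rewrite ler_pdivrMl ?normr_gt0// distrC.
by rewrite [_ + p]addrC; exact: fin key.
Qed.

Lemma ccvg_uniform Wn W f F K : exhausted_by Wn W -> ccvg W f F ->
  compact K -> K `<=` W -> forall e : R, 0 < e ->
  exists N : nat, forall n x, (N <= n)%N -> K x -> `|F x - f n x| < e.
Proof.
move=> ex cF /compact_near_coveringP cK KW e e0.
have [|N _ H] := cK nat \oo (fun n x => `|F x - f n x| < e) _.
  move=> x Kx; have e2 : 0 < e / 2 by rewrite divr_gt0.
  have [r r0 [N H]] := (ccvgP W f F).1 cF x (KW x Kx) _ e2.
  have [s s0 HF] := continuous_norm (ccvg_continuous ex cF (KW x Kx)) e2.
  have [t t0 [tr ts]] := exists_lt_both r0 s0.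
  exists ([set y | `|y - x| < t], [set n | (N <= n)%N]) => /=.
    split; last by exists N.
    by apply/near_normP; exists t.
  move=> [y n] /= [yt Nn].
  have h1 := H n y Nn (lt_trans yt tr).
  have h2 := HF y (lt_trans yt ts); rewrite distrC in h2.
  have -> : F y - f n y = (F y - F x) + (F x - f n y) by rewrite addrA subrK.
  by rewrite (le_lt_trans (ler_normD _ _))// (splitr e) ltrD.
by exists N => n x Nn Kx; exact: H.
Qed.

End continuous_convergence.

(** * Convergence of derivatives *)

Section smooth_functions.
Context {R : realType}.
Implicit Types (u v F G : 'rV[R]_2 -> R) (p x y : 'rV[R]_2) (i j : 'I_2).
Implicit Types W : set 'rV[R]_2.

Lemma smooth_continuous W v x : smooth_on W v -> W x -> {for x, continuous v}.
Proof. by move=> sv Wx; have [] := sv [::] x Wx. Qed.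

Lemma smooth_derivable W v x i : smooth_on W v -> W x ->
  derivable v x (delta_mx 0 i).
Proof. by move=> sv Wx; have [_ +] := sv [::] x Wx; apply. Qed.

Lemma smooth_pderiv W v i : smooth_on W v -> smooth_on W (pderiv i v).
Proof.
move=> sv s x Wx; have := sv (rcons s i) x Wx.
by rewrite /iter_pderiv -cats1 foldr_cat.
Qed.

Lemma smooth_twice W v x : smooth_on W v -> W x -> twice_derivable v x.
Proof.
move=> sv Wx j; split; first exact: smooth_derivable sv Wx.
exact: smooth_derivable (smooth_pderiv j sv) Wx.
Qed.

Lemma pderiv_eq_on W u v i : open W -> (forall x, W x -> u x = v x) ->
  forall x, W x -> pderiv i u x = pderiv i v x.
Proof.
move=> oW uv x Wx; apply: near_eq_derive.
have : \forall y \near x, W y by apply: open_nbhs_nbhs.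
by apply: filterS => y /uv.
Qed.

Lemma derivable_eq_on W u v i : open W -> (forall x, W x -> u x = v x) ->
  forall x, W x -> derivable u x (delta_mx 0 i) -> derivable v x (delta_mx 0 i).
Proof.
move=> oW uv x Wx; apply: near_eq_derivable.
have : \forall y \near x, W y by apply: open_nbhs_nbhs.
by apply: filterS => y /uv.
Qed.

Lemma laplacian_sub u v x : (\forall y \near x, twice_derivable u y /\ twice_derivable v y) ->
  twice_derivable (fun y => u y - v y) x /\
  laplacian (fun y => u y - v y) x = laplacian u x - laplacian v x.
Proof.
move=> n2.
have key k : is_derive x (delta_mx 0 k) (pderiv k (fun y => u y - v y))
    (pderiv k (pderiv k u) x - pderiv k (pderiv k v) x).
  apply: (@is_derive_pderiv _ _ (fun y => pderiv k u y - pderiv k v y)).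
    apply: filterS n2 => y [/(_ k) [/derivableP hu _] /(_ k) [/derivableP hv _]].
    exact: is_deriveB hu hv.
  have [/(_ k) [_ /derivableP hu] /(_ k) [_ /derivableP hv]] := nbhs_singleton n2.
  exact: is_deriveB hu hv.
split.
  move=> k; split; last by case: (key k).
  have [/(_ k) [hu _] /(_ k) [hv _]] := nbhs_singleton n2.
  exact: derivableB hu hv.
have E k : pderiv k (pderiv k (fun y => u y - v y)) x =
    pderiv k (pderiv k u) x - pderiv k (pderiv k v) x by case: (key k).
by rewrite !laplacianE !E opprD addrACA.
Qed.

(** The third derivatives involved differ by two exchanges of partial derivatives. *)
Lemma laplacian_pderiv W v i : open W -> smooth_on W v ->
  forall x, W x -> pderiv i (laplacian v) x = laplacian (pderiv i v) x.
Proof.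
move=> oW sv x Wx.
have nW y : W y -> \forall z \near y, W z by move=> Wy; apply: open_nbhs_nbhs.
have swap w (j k : 'I_2) y : smooth_on W w -> W y ->
    pderiv j (pderiv k w) y = pderiv k (pderiv j w) y.
  move=> sw Wy; apply: pderivC.
  - apply: filterS (nW y Wy) => z Wz; split; first exact: smooth_derivable sw Wz.
    split; first exact: smooth_derivable sw Wz.
    by split; exact: smooth_derivable (smooth_pderiv _ sw) Wz.
  - exact: smooth_continuous (smooth_pderiv _ (smooth_pderiv _ sw)) Wy.
  - exact: smooth_continuous (smooth_pderiv _ (smooth_pderiv _ sw)) Wy.
have key j : pderiv i (pderiv j (pderiv j v)) x = pderiv j (pderiv j (pderiv i v)) x.
  rewrite (swap _ i j x (smooth_pderiv j sv) Wx).
  by apply: (pderiv_eq_on j oW _ Wx) => y Wy; exact: swap.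
rewrite laplacianE -(key 0) -(key 1).
have d2 j : derivable (pderiv j (pderiv j v)) x (delta_mx 0 i).
  exact: smooth_derivable (smooth_pderiv _ (smooth_pderiv _ sv)) Wx.
have -> : laplacian v = pderiv 0 (pderiv 0 v) + pderiv 1 (pderiv 1 v).
  by apply/funext => y; rewrite laplacianE.
by rewrite /pderiv deriveD; [|exact: d2|exact: d2].
Qed.

End smooth_functions.

Section elliptic_regularity.
Context {R : realType}.
Implicit Types (f g : nat -> 'rV[R]_2 -> R) (F G H : 'rV[R]_2 -> R).
Implicit Types (p x y : 'rV[R]_2) (i j : 'I_2) (W : set 'rV[R]_2).
Implicit Types Wn : nat -> set 'rV[R]_2.

Lemma compact_norm_ball p (r : R) : compact [set x : 'rV[R]_2 | `|x - p| <= r].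
Proof.
apply: bounded_closed_compact.
  exists (`|p| + r); split; first exact: num_real.
  move=> K hK y /= yd.
  apply: le_trans (ltW hK); rewrite -(subrK p y) addrC.
  by rewrite (le_trans (ler_normD _ _))// lerD2l.
move=> q cl /=; rewrite leNgt; apply/negP => h.
have e0 : 0 < `|q - p| - r by rewrite subr_gt0.
have /cl [z [/= zr]] : \forall z \near q, `|z - q| < `|q - p| - r.
  by apply/near_normP; exists (`|q - p| - r).
apply/negP; rewrite -leNgt lerBlDr.
have -> : q - p = (q - z) + (z - p) by rewrite addrA subrK.
by rewrite (le_trans (ler_normD _ _))// [`|q - z|]distrC lerD2l.
Qed.

(** The gradient estimate on the difference [f n - f m], which is uniformly small
near [p] together with its Laplacian. *)
Lemma ccvg_pderiv_cauchy Wn W f F H i : exhausted_by Wn W ->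
  (forall n, open (Wn n)) -> (forall n, smooth_on (Wn n) (f n)) ->
  ccvg W f F -> ccvg W (fun n => laplacian (f n)) H ->
  forall p, W p -> forall e : R, 0 < e ->
  exists2 r : R, 0 < r & exists N : nat, forall n m x, (N <= n)%N -> (N <= m)%N ->
    `|x - p| < r -> `|pderiv i (f n) x - pderiv i (f m) x| <= e.
Proof.
move=> ex oWn sf cF cH p Wp e e0.
have [r0 r00 [N0 HN0]] := exhausted_nbhs ex Wp.
have [r rpos r3] : exists2 r : R, 0 < r & 3 * r < r0.
  by exists (r0 / 4); move: r00; clear; lra.
pose K := [set x : 'rV[R]_2 | `|x - p| <= 3 * r].
have KW : K `<=` W by move=> x /= xK; exact: (HN0 N0 x (leqnn _) (le_lt_trans xK r3)).2.
(* The gradient estimate on squares of size [r] multiplies the bound by [c]. *)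
pose c := 4 / r + r.
have c0 : 0 < c by rewrite /c addr_gt0// divr_gt0.
have ec : 0 < e / c by rewrite divr_gt0.
have [N1 HN1] := ccvg_uniform ex cF (@compact_norm_ball p (3 * r)) KW ec.
have [N2 HN2] := ccvg_uniform ex cH (@compact_norm_ball p (3 * r)) KW ec.
exists r => //; exists (maxn N0 (maxn N1 N2)) => n m x.
rewrite !geq_max => /andP[n0 /andP[n1 n2]] /andP[m0 /andP[m1 m2]] xr.
pose v y := f n y - f m y.
have inK y : `|y - x| < 2 * r -> K y.
  move=> yx; rewrite /K /=.
  have -> : y - p = (y - x) + (x - p) by rewrite addrA subrK.
  rewrite (le_trans (ler_normD _ _))//.
  have -> : 3 * r = 2 * r + r by ring.
  by rewrite lerD// ltW.
have Wk k y : (N0 <= k)%N -> K y -> Wn k y.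
  by move=> k0 Ky; exact: (HN0 k y k0 (le_lt_trans Ky r3)).1.
have vdist (a b c' d : R) : `|a - b| < d -> `|a - c'| < d -> `|b - c'| < 2 * d.
  move=> ab ac; have -> : b - c' = (b - a) + (a - c') by rewrite addrA subrK.
  rewrite (le_lt_trans (ler_normD _ _))// [`|b - a|]distrC mulrDl mul1r.
  exact: ltrD.
have r2 : r < 2 * r by move: rpos; clear; lra.
have D : `|pderiv i v x| <= 2 * (2 * (e / c)) / r + 2 * (e / c) * r / 2.
  apply: (gradient_estimate (r := 2 * r) i rpos r2) => y /inK Ky.
  have Wny := Wk n y n0 Ky; have Wmy := Wk m y m0 Ky.
  have n2d : \forall z \near y, twice_derivable (f n) z /\ twice_derivable (f m) z.
    apply: filterS2 (open_nbhs_nbhs (conj (oWn n) Wny)) (open_nbhs_nbhs (conj (oWn m) Wmy)).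
    move=> z Wnz Wmz; split; first exact: smooth_twice (sf n) Wnz.
    exact: smooth_twice (sf m) Wmz.
  have [t2 lapv] := laplacian_sub n2d.
  split.
  - apply: continuousB; first exact: smooth_continuous (sf n) Wny.
    exact: smooth_continuous (sf m) Wmy.
  - exact: t2.
  - by apply: ltW; apply: vdist (HN1 n y n1 Ky) (HN1 m y m1 Ky).
  - by rewrite lapv; apply: vdist (HN2 n y n2 Ky) (HN2 m y m2 Ky).
have E : pderiv i v x = pderiv i (f n) x - pderiv i (f m) x.
  have xx : K x by apply: inK; rewrite subrr normr0 mulr_gt0.
  have d1 : derivable (f n) x (delta_mx 0 i) := smooth_derivable (sf n) (Wk n x n0 xx).
  have d2 : derivable (f m) x (delta_mx 0 i) := smooth_derivable (sf m) (Wk m x m0 xx).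
  by have [_] := is_deriveB (derivableP d1) (derivableP d2).
move: D; rewrite E; move: (_ - _) => a; move=> /le_trans; apply.
have -> : 2 * (2 * (e / c)) / r + 2 * (e / c) * r / 2 = e / c * c.
  by move: (e / c) => b; rewrite /c; field; rewrite gt_eqF.
by rewrite divfK// gt_eqF.
Qed.

Lemma ccvg_pderiv Wn W f F H i : exhausted_by Wn W ->
  (forall n, open (Wn n)) -> (forall n, smooth_on (Wn n) (f n)) ->
  ccvg W f F -> ccvg W (fun n => laplacian (f n)) H ->
  (forall x, W x -> derivable F x (delta_mx 0 i)) /\
  ccvg W (fun n => pderiv i (f n)) (pderiv i F).
Proof.
move=> ex oWn sf cF cH.
pose G p := lim (pderiv i (f nx.1) nx.2 @[nx --> seqnbhs p]).
have cG : ccvg W (fun n => pderiv i (f n)) G.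
  move=> p Wp.
  (* The estimate compares [f n] with one fixed [f k], whose derivative is
     continuous at [p]. *)
  have : cvg (pderiv i (f nx.1) nx.2 @[nx --> seqnbhs p]); last exact.
  apply: cauchy_cvg; apply: cauchy_exP => e e0.
  have e2 : 0 < e / 2 by rewrite divr_gt0.
  have [r r0 [N HN]] := ccvg_pderiv_cauchy i ex oWn sf cF cH Wp e2.
  have [s s0 [M HM]] := exhausted_nbhs ex Wp.
  pose k := maxn N M.
  have Wkp : Wn k p.
    by apply: (HM k p _ _).1; [exact: leq_maxr|rewrite subrr normr0].
  have [t t0 Ht] := continuous_norm (smooth_continuous (smooth_pderiv i (sf k)) Wkp) e2.
  have [t' t'0 [t'r t't]] := exists_lt_both r0 t0.
  exists (pderiv i (f k) p); exists t' => //; exists N => n x Nn xt' /=.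
  rewrite -ball_normE /=.
  have h1 := HN k n x (leq_maxl _ _) Nn (lt_trans xt' t'r).
  have h2 := Ht x (lt_trans xt' t't).
  rewrite (splitr e) (le_lt_trans (ler_distD (pderiv i (f k) x) _ _))//.
  exact: ltr_leD h2 h1.
have D p : W p -> is_derive p (delta_mx 0 i) F (G p).
  apply: (ccvg_derive ex cF) cG => n x Wnx.
  exact: smooth_derivable (sf n) Wnx.
split; first by move=> x /D [].
apply: (ccvg_ext ex _ _ cG) => // x /D [_ E].
by rewrite /pderiv E.
Qed.

End elliptic_regularity.

Section Ck_convergence.
Context {R : realType}.
Implicit Types (f g : nat -> 'rV[R]_2 -> R) (F G H : 'rV[R]_2 -> R).
Implicit Types (p x y : 'rV[R]_2) (i j : 'I_2) (W : set 'rV[R]_2).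
Implicit Types Wn : nat -> set 'rV[R]_2.

(** Local convergence in C^k. The [f n] are required to be derivable on [Wn n], since
their values elsewhere are arbitrary. *)
Fixpoint Ck_cvg Wn W (k : nat) f F : Prop := ccvg W f F /\
  if k is k'.+1 then
    [/\ forall n x i, Wn n x -> derivable (f n) x (delta_mx 0 i),
        forall x i, W x -> derivable F x (delta_mx 0 i) &
        forall i, Ck_cvg Wn W k' (fun n => pderiv i (f n)) (pderiv i F)]
  else True.

Lemma Ck_ccvg Wn W k f F : Ck_cvg Wn W k f F -> ccvg W f F.
Proof. by case: k => [|k] []. Qed.

Lemma exhausted_open Wn W : exhausted_by Wn W -> open W.
Proof.
move=> ex; rewrite openE => p Wp; have [r r0 [N H]] := exhausted_nbhs ex Wp.
by apply/near_normP; exists r => // x xr; exact: (H N x (leqnn N) xr).2.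
Qed.

Lemma Ck_ext Wn W k f g F G : exhausted_by Wn W -> (forall n, open (Wn n)) ->
  (forall n x, Wn n x -> f n x = g n x) -> (forall x, W x -> F x = G x) ->
  Ck_cvg Wn W k f F -> Ck_cvg Wn W k g G.
Proof.
move=> ex oWn; have oW := exhausted_open ex.
elim: k f g F G => [|k IH] f g F G fg FG [cF dF].
  by split => //; exact: ccvg_ext ex fg FG cF.
split; first exact: ccvg_ext ex fg FG cF.
case: dF => df dF cdF; split.
- move=> n x i Wnx; exact: derivable_eq_on (oWn n) (fg n) x Wnx (df n x i Wnx).
- move=> x i Wx; exact: derivable_eq_on oW FG x Wx (dF x i Wx).
- move=> i; apply: IH (cdF i).
    by move=> n x Wnx; exact: pderiv_eq_on (oWn n) (fg n) x Wnx.
  by move=> x Wx; exact: pderiv_eq_on oW FG x Wx.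
Qed.

Lemma CkD Wn W k f g F G : exhausted_by Wn W -> (forall n, open (Wn n)) ->
  Ck_cvg Wn W k f F -> Ck_cvg Wn W k g G ->
  Ck_cvg Wn W k (fun n x => f n x + g n x) (fun x => F x + G x).
Proof.
move=> ex oWn; elim: k f g F G => [|k IH] f g F G [cF dF] [cG dG].
  by split => // p Wp; apply: cvgD; [exact: cF|exact: cG].
split; first by move=> p Wp; apply: cvgD; [exact: cF|exact: cG].
case: dF => df dF cdF; case: dG => dg dG cdG; split.
- by move=> n x i Wnx; apply: derivableD; [exact: df|exact: dg].
- by move=> x i Wx; apply: derivableD; [exact: dF|exact: dG].
- move=> i; apply: (Ck_ext ex oWn) (IH _ _ _ _ (cdF i) (cdG i)).
    by move=> n x Wnx; rewrite [RHS]deriveD; [|exact: df|exact: dg].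
  by move=> x Wx; rewrite [RHS]deriveD; [|exact: dF|exact: dG].
Qed.

Lemma Ck_pred Wn W k f F : Ck_cvg Wn W k.+1 f F -> Ck_cvg Wn W k f F.
Proof.
elim: k f F => [|k IH] f F [cF dF]; first by split.
by split=> //; case: dF => df dF cdF; split => // i; exact: IH.
Qed.

Lemma CkM Wn W k f g F G : exhausted_by Wn W -> (forall n, open (Wn n)) ->
  Ck_cvg Wn W k f F -> Ck_cvg Wn W k g G ->
  Ck_cvg Wn W k (fun n x => f n x * g n x) (fun x => F x * G x).
Proof.
move=> ex oWn; elim: k f g F G => [|k IH] f g F G CF CG.
  have [cF _] := CF; have [cG _] := CG.
  by split => // p Wp; apply: cvgM; [exact: cF|exact: cG].
have CF' := Ck_pred CF; have CG' := Ck_pred CG.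
have [cF dF] := CF; have [cG dG] := CG.
split; first by move=> p Wp; apply: cvgM; [exact: cF|exact: cG].
case: dF => df dF cdF; case: dG => dg dG cdG; split.
- by move=> n x i Wnx; apply: derivableM; [exact: df|exact: dg].
- by move=> x i Wx; apply: derivableM; [exact: dF|exact: dG].
- move=> i.
  apply: (Ck_ext ex oWn) (CkD ex oWn (IH _ _ _ _ CF' (cdG i)) (IH _ _ _ _ CG' (cdF i))).
    by move=> n x Wnx; rewrite [RHS]deriveM; [|exact: df|exact: dg].
  by move=> x Wx; rewrite [RHS]deriveM; [|exact: dF|exact: dG].
Qed.

Lemma is_derive_exp2 F x v : derivable F x v ->
  is_derive x v (fun y => expR (2 * F y)) ((2 * expR (2 * F x)) * 'D_v F x).
Proof.
move=> /derivableP dF.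
rewrite mulrAC; apply: is_derive_eq; last first.
  exact: mulrC.
apply: (@is_derive_comp _ (@expR R) (fun y => 2 * F y)).
Qed.

Lemma Ck_exp2 Wn W k f F : exhausted_by Wn W -> (forall n, open (Wn n)) ->
  Ck_cvg Wn W k f F ->
  Ck_cvg Wn W k (fun n x => expR (2 * f n x)) (fun x => expR (2 * F x)).
Proof.
move=> ex oWn; elim: k f F => [|k IH] f F CF.
  have [cF _] := CF; split => // p Wp.
  have c2 : 2 * f nx.1 nx.2 @[nx --> seqnbhs p] --> 2 * F p.
    by apply: cvgM; [exact: cvg_cst|exact: cF].
  exact: (cvg_comp _ _ c2 (@continuous_expR R _)).
have CE := IH f F (Ck_pred CF); have [cF dF] := CF.
split.
  move=> p Wp; exact: (Ck_ccvg CE).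
case: dF => df dF cdF; split.
- by move=> n x i Wnx; case: (is_derive_exp2 (df n x i Wnx)).
- by move=> x i Wx; case: (is_derive_exp2 (dF x i Wx)).
- move=> i.
  apply: (Ck_ext ex oWn) (CkM ex oWn (CkD ex oWn CE CE) (cdF i)).
    move=> n x Wnx; have [_ E] := is_derive_exp2 (df n x i Wnx).
    by rewrite [RHS]E [2 * expR _]mulr_natl mulr2n.
  move=> x Wx; have [_ E] := is_derive_exp2 (dF x i Wx).
  by rewrite [RHS]E [2 * expR _]mulr_natl mulr2n.
Qed.

(** The Laplacian commutes with partial derivatives, so each derivative of order
[k] satisfies the hypotheses of [ccvg_pderiv]. *)
Lemma Ck_elliptic Wn W k f F H : exhausted_by Wn W -> (forall n, open (Wn n)) ->
  (forall n, smooth_on (Wn n) (f n)) ->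
  Ck_cvg Wn W k f F -> Ck_cvg Wn W k (fun n => laplacian (f n)) H ->
  Ck_cvg Wn W k.+1 f F.
Proof.
move=> ex oWn; elim: k f F H => [|k IH] f F H sf CF CH.
  have cF := Ck_ccvg CF; split; first exact: cF.
  have h i := ccvg_pderiv i ex oWn sf cF (Ck_ccvg CH).
  split.
  - by move=> n x i Wnx; exact: smooth_derivable (sf n) Wnx.
  - by move=> x i Wx; exact: (h i).1.
  - by move=> i; split => //; exact: (h i).2.
have [cF [df dF cdF]] := CF; have [cH [_ _ cdH]] := CH.
split; first exact: cF.
split; [exact: df|exact: dF|move=> i].
apply: (IH _ _ (pderiv i H)); last 2 first.
- exact: cdF.
- apply: (Ck_ext ex oWn) (cdH i) => // n x Wnx.
  exact: laplacian_pderiv (oWn n) (sf n) x Wnx.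
by move=> n; exact: smooth_pderiv.
Qed.

(** An iterated derivative of [F] is the limit in C^1 of some sequence. *)
Lemma Ck_smooth Wn W f F : exhausted_by Wn W ->
  (forall k, Ck_cvg Wn W k f F) -> smooth_on W F.
Proof.
move=> ex CF s.
have key : forall k, exists f', Ck_cvg Wn W k f' (iter_pderiv s F).
  elim/last_ind: s f F CF => [|s i IH] f F CF k /=; first by exists f.
  rewrite /iter_pderiv -cats1 foldr_cat /=.
  apply: (IH (fun n => pderiv i (f n))) => m.
  by have [_ [_ _ cd]] := CF m.+1; exact: cd.
have [f' [cf [_ df _]]] := key 1%N.
move=> p Wp; split; first exact: ccvg_continuous ex cf Wp.
by move=> i; exact: df.
Qed.

Lemma Ck2_laplacian Wn W f F p : Ck_cvg Wn W 2 f F -> W p ->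
  laplacian (f n) p @[n --> \oo] --> laplacian F p.
Proof.
move=> [_ [_ _ CF]] Wp; rewrite laplacianE.
have D i : pderiv i (pderiv i (f n)) p @[n --> \oo] --> pderiv i (pderiv i F) p.
  have [_ [_ _ CF']] := CF i.
  by have [cc _] := CF' i; exact: ccvg_pointwise cc Wp.
have -> : (fun n => laplacian (f n) p) =
    (fun n => pderiv 0 (pderiv 0 (f n)) p + pderiv 1 (pderiv 1 (f n)) p).
  by apply/funext => n; rewrite laplacianE.
by apply: cvgD; exact: D.
Qed.

End Ck_convergence.

(** * Comparison and radial functions *)

Section radial_functions.
Context {R : realType}.
Implicit Types (u w F : 'rV[R]_2 -> R) (a b p q x y : 'rV[R]_2) (i j : 'I_2).
Implicit Types (W : set 'rV[R]_2) (phi dphi : R -> R).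

#[local] Existing Instance is_derive_coord.

Definition sqdist a q : R := (q 0 0 - a 0 0) ^+ 2 + (q 0 1 - a 0 1) ^+ 2.

(** Twice the logarithm of the distance to [a], a harmonic function. *)
Definition lnsq a q : R := ln (sqdist a q).

Lemma sqdist_ge0 a q : 0 <= sqdist a q.
Proof. by rewrite addr_ge0 ?sqr_ge0. Qed.

Lemma sqdist_gt0 a q : q != a -> 0 < sqdist a q.
Proof.
move=> qa; rewrite lt0r sqdist_ge0 andbT; apply: contra qa.
rewrite paddr_eq0 ?sqr_ge0// !sqrf_eq0 !subr_eq0 => /andP[/eqP h0 /eqP h1].
by apply/eqP/rowP => i; case: (ord2P i) => ->.
Qed.

Lemma continuous_sqdist a : continuous (sqdist a).
Proof.
move=> x.
have key (F : set_system 'rV[R]_2) : Filter F -> y @[y --> F] --> x ->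
    sqdist a y @[y --> F] --> sqdist a x.
  move=> FF Fx.
  have cj j : y 0 j - a 0 j @[y --> F] --> x 0 j - a 0 j.
    apply: cvgB; last exact: cvg_cst.
    exact: (cvg_comp _ _ Fx (@continuous_coord R j x)).
  by apply: cvgD; (apply: cvgM; exact: cj).
exact: (key (nbhs x) _ (@cvg_id _ _)).
Qed.

Lemma near_neq a q : q != a -> \forall x \near q, x != a.
Proof.
move=> /sqdist_gt0 h.
have : \forall x \near q, 0 < sqdist a x.
  by move/cvgr_gt: (@continuous_sqdist a q); apply.
apply: filterS => x x0; apply: contraTneq x0 => ->.
by rewrite /sqdist !subrr expr0n addr0 ltxx.
Qed.

Lemma is_derive_sqdist a q j :
  is_derive q (delta_mx 0 j) (sqdist a) (2 * (q 0 j - a 0 j)).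
Proof.
apply: is_derive_eq; rewrite /GRing.scale/= !mxE !eqxx /=.
by case: (ord2P j) => -> /=; ring.
Qed.

Lemma is_derive_lnsq a q j : q != a ->
  is_derive q (delta_mx 0 j) (lnsq a) ((sqdist a q)^-1 * (2 * (q 0 j - a 0 j))).
Proof.
move=> qa; apply: (@is_derive_comp _ (@ln R) (sqdist a)).
  exact/is_derive1_ln/sqdist_gt0.
exact: is_derive_sqdist.
Qed.

Lemma continuous_lnsq a q : q != a -> {for q, continuous (lnsq a)}.
Proof.
move=> qa; apply: (@continuous_comp _ _ _ (sqdist a) (@ln R)).
  exact: continuous_sqdist.
exact/continuous_ln/sqdist_gt0.
Qed.

Lemma is_derive_lnsq1 a q j : q != a ->
  is_derive q (delta_mx 0 j) (fun x => (sqdist a x)^-1 * (2 * (x 0 j - a 0 j)))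
    (2 / sqdist a q - (2 * (q 0 j - a 0 j) / sqdist a q) ^+ 2).
Proof.
move=> qa; have s0 := sqdist_gt0 qa.
have h1 : is_derive q (delta_mx 0 j) (fun x => (sqdist a x)^-1)
    (- (sqdist a q) ^- 2 * (2 * (q 0 j - a 0 j))).
  apply: (@is_derive_comp _ (fun t : R => t^-1) (sqdist a)).
    have -> : - (sqdist a q) ^- 2 = - (sqdist a q) ^- 2 *: (1 : R).
      by rewrite /GRing.scale/= mulr1.
    exact: (is_deriveV (f := id) (lt0r_neq0 s0)).
  exact: is_derive_sqdist.
have h2 : is_derive q (delta_mx 0 j) (fun x : 'rV[R]_2 => 2 * (x 0 j - a 0 j)) 2.
  by apply: is_derive_eq; rewrite /GRing.scale/= !mxE !eqxx /=; ring.
apply: is_derive_eq (is_deriveM h1 h2) _.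
rewrite /GRing.scale/=; field; exact: lt0r_neq0.
Qed.

(** As [lnsq a] is harmonic, the chain rule leaves the second derivative of [phi]
times the squared gradient of [lnsq a], which is [4 / sqdist a q]. *)
Lemma laplacian_radial phi dphi (d2phi : R) a q : q != a ->
  (\forall t \near lnsq a q, is_derive (t : R) 1 phi (dphi t)) ->
  is_derive (lnsq a q) 1 dphi d2phi ->
  twice_derivable (fun x => phi (lnsq a x)) q /\
  laplacian (fun x => phi (lnsq a x)) q = 4 * d2phi / sqdist a q.
Proof.
move=> qa hphi ddphi; have s0 := sqdist_gt0 qa.
pose D j x := dphi (lnsq a x) * ((sqdist a x)^-1 * (2 * (x 0 j - a 0 j))).
have n1 j : \forall x \near q, is_derive x (delta_mx 0 j) (fun x => phi (lnsq a x)) (D j x).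
  have := continuous_lnsq qa; move=> /(_ _ hphi) /= nE.
  apply: filterS2 (near_neq qa) nE => x xa hE.
  by apply: is_derive_comp; [exact: hE|exact: is_derive_lnsq].
have d2 j : is_derive q (delta_mx 0 j) (pderiv j (fun x => phi (lnsq a x)))
    (d2phi * (2 * (q 0 j - a 0 j) / sqdist a q) ^+ 2
     + dphi (lnsq a q) * (2 / sqdist a q - (2 * (q 0 j - a 0 j) / sqdist a q) ^+ 2)).
  apply: (is_derive_pderiv (n1 j)).
  have h1 : is_derive q (delta_mx 0 j) (fun x => dphi (lnsq a x))
      (d2phi * ((sqdist a q)^-1 * (2 * (q 0 j - a 0 j)))).
    by apply: is_derive_comp; exact: is_derive_lnsq.
  apply: is_derive_eq (is_deriveM h1 (is_derive_lnsq1 j qa)) _.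
  rewrite /GRing.scale/=; move: (sqdist a q) (q 0 j - a 0 j) (dphi _) => s t e; ring.
split.
  move=> j; split; last by case: (d2 j).
  by case: (nbhs_singleton (n1 j)).
have E' j : pderiv j (pderiv j (fun x => phi (lnsq a x))) q =
    d2phi * (2 * (q 0 j - a 0 j) / sqdist a q) ^+ 2
     + dphi (lnsq a q) * (2 / sqdist a q - (2 * (q 0 j - a 0 j) / sqdist a q) ^+ 2).
  by case: (d2 j).
rewrite laplacianE !E' -addrACA -!mulrDr.
have -> : (2 * (q 0 0 - a 0 0) / sqdist a q) ^+ 2 + (2 * (q 0 1 - a 0 1) / sqdist a q) ^+ 2
    = 4 / sqdist a q.
  rewrite !exprMn -mulrDl -mulrDr -/(sqdist a q) expr2.
  by field; exact: lt0r_neq0.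
have -> : 2 / sqdist a q - (2 * (q 0 0 - a 0 0) / sqdist a q) ^+ 2
    + (2 / sqdist a q - (2 * (q 0 1 - a 0 1) / sqdist a q) ^+ 2) = 0.
  rewrite /sqdist; field; exact: lt0r_neq0.
by rewrite mulr0 addr0; ring.
Qed.

Lemma continuous_radial phi a q (e : R) : q != a -> is_derive (lnsq a q) 1 phi e ->
  {for q, continuous (fun x => phi (lnsq a x))}.
Proof.
move=> qa [hphi _]; apply: (@continuous_comp _ _ _ (lnsq a) phi).
  exact: continuous_lnsq.
by apply: differentiable_continuous; apply/derivable1_diffP.
Qed.

Definition supersolution W u := forall x, W x ->
  [/\ {for x, continuous u}, twice_derivable u x & laplacian u x <= expR (2 * u x)].

Definition subsolution W w := forall x, W x ->
  [/\ {for x, continuous w}, twice_derivable w x & expR (2 * w x) <= laplacian w x].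

(** Where [u < w], [laplacian (w - u) >= expR (2 * w) - expR (2 * u) > 0]. *)
Lemma comparison W u w : open W -> bounded_set W ->
  supersolution W u -> subsolution W w ->
  (forall q, closure W q -> ~ W q -> forall e, 0 < e ->
     \forall x \near q, W x -> w x < u x + e) ->
  forall x, W x -> w x <= u x.
Proof.
move=> oW bW su sw bd x Wx; rewrite -subr_le0.
have ns y : W y -> \forall z \near y, twice_derivable w z /\ twice_derivable u z.
  move=> Wy; have nW : \forall z \near y, W z by apply: open_nbhs_nbhs.
  apply: filterS nW => z Wz; have [_ hu _] := su z Wz.
  by have [_ hw _] := sw z Wz.
apply: (@max_principle _ W (fun y => w y - u y)) Wx.
- exact: oW.
- exact: bW.
- move=> y Wy; have [cu _ _] := su y Wy; have [cw _ _] := sw y Wy.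
  exact: continuousB cw cu.
- by move=> y i /ns/laplacian_sub [/(_ i) [h _] _].
- by move=> y i /ns/laplacian_sub [/(_ i) [_ h] _].
- move=> y Wy; have [_ ->] := laplacian_sub (ns y Wy) => h.
  have [_ _ lu] := su y Wy; have [_ _ lw] := sw y Wy.
  rewrite subr_gt0 (le_lt_trans lu)// (lt_le_trans _ lw)//.
  by rewrite ltr_expR ltr_pM2l// -subr_gt0.
- move=> q clq nWq e e0; apply: filterS (bd q clq nWq e e0) => y h Wy.
  by rewrite ltrBlDl; exact: h.
Qed.

End radial_functions.

(** * Lower bounds for solutions that blow up *)

Section two_punctures.
Context {R : realType}.
Implicit Types (u w F : 'rV[R]_2 -> R) (a b p q x y : 'rV[R]_2) (i j : 'I_2).
Implicit Types (W : set 'rV[R]_2) (s t : R).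

(** With [r] the distance to [a], [expR (2 * profile (lnsq a x))] is
[(1 + r^(1/3)) / r^(5/3)]. The product of two such factors, for points [a] and
[b], is a conformal metric whose curvature is bounded above by a negative
constant: the exponent 5/3 is small enough for this near [a] and [b] and large
enough at infinity. *)
Definition profile t : R := 2^-1 * ln (1 + expR (t / 6)) - 5 / 12 * t.

Definition profile1 t : R :=
  12^-1 * (expR (t / 6) / (1 + expR (t / 6))) - 5 / 12.

Definition profile2 t : R :=
  72^-1 * (expR (t / 6) / (1 + expR (t / 6)) ^+ 2).

Lemma is_derive_exp6 t : is_derive t 1 (fun x : R => expR (x / 6)) (expR (t / 6) / 6).
Proof.
apply: (@is_derive1_comp R expR (fun x : R => x / 6)).
by apply: is_derive_eq; rewrite /GRing.scale/=; ring.
Qed.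

Lemma exp61_gt0 t : 0 < 1 + expR (t / 6).
Proof. by rewrite addr_gt0// expR_gt0. Qed.

Lemma is_derive_profile t : is_derive t 1 profile (profile1 t).
Proof.
have h1 : is_derive t 1 (fun x : R => 1 + expR (x / 6)) (expR (t / 6) / 6).
  by rewrite -[X in is_derive _ _ _ X]add0r; apply: is_deriveD (is_derive_exp6 t).
have h2 := @is_derive1_comp R (@ln R) _ t _ _ (is_derive1_ln (exp61_gt0 t)) h1.
apply: is_derive_eq (is_deriveB (is_deriveZ (2^-1) h2)
  (is_deriveZ (5 / 12) (is_derive_id t 1))) _.
rewrite /GRing.scale/= /profile1; field; exact: lt0r_neq0 (exp61_gt0 t).
Qed.

Lemma is_derive_profile1 t : is_derive t 1 profile1 (profile2 t).
Proof.
have h1 : is_derive t 1 (fun x : R => 1 + expR (x / 6)) (expR (t / 6) / 6).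
  by rewrite -[X in is_derive _ _ _ X]add0r; apply: is_deriveD (is_derive_exp6 t).
have n0 := lt0r_neq0 (exp61_gt0 t).
have h2 := is_deriveM (is_derive_exp6 t) (is_deriveV (f := fun x : R => 1 + expR (x / 6)) n0 h1).
apply: is_derive_eq (is_deriveB (is_deriveZ (12^-1) h2)
  (is_derive_cst (5 / 12 : R) t 1)) _.
by rewrite /GRing.scale/= /profile2; field.
Qed.

(** With [s] and [t] the cube roots of the distances to the two points, this is
[expR (2 * w) <= laplacian w] for a multiple of the product metric. The larger of [s] and [t],
say [t], is at least [m], so [1 + t <= (1 + m^-1) * t], and
[(1 + s) ^+ 3 * (1 + t)] is at most [(1 + m^-1) ^+ 4 * t ^+ 4]. *)
Lemma two_point_ineq (m s t : R) : 0 < m -> 0 < s -> 0 < t -> (m <= s) || (m <= t) ->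
  18^-1 * (m / (1 + m^-1) ^+ 4) * ((1 + s) / s ^+ 5 * ((1 + t) / t ^+ 5)) <=
  18^-1 * (s / (1 + s) ^+ 2) / s ^+ 6 + 18^-1 * (t / (1 + t) ^+ 2) / t ^+ 6.
Proof.
move=> m0.
have key (x y : R) : 0 < x -> 0 < y -> x <= y -> m <= y ->
    18^-1 * (m / (1 + m^-1) ^+ 4) * ((1 + x) / x ^+ 5 * ((1 + y) / y ^+ 5)) <=
    18^-1 * (x / (1 + x) ^+ 2) / x ^+ 6.
  move=> x0 y0 xy my.
  have x1 : 0 < 1 + x by rewrite addr_gt0.
  have y1 : 0 < 1 + y by rewrite addr_gt0.
  have m1 : 0 < 1 + m^-1 by rewrite addr_gt0// invr_gt0.
  have hy : 1 + y <= (1 + m^-1) * y.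
    by rewrite mulrDl mul1r addrC lerD2l ler_pdivlMl// mulr1.
  have h4 : (1 + x) ^+ 3 * (1 + y) <= (1 + m^-1) ^+ 4 * y ^+ 4.
    rewrite -exprMn [leRHS]exprSr; apply: ler_pM.
    - by rewrite exprn_ge0// ltW.
    - exact: ltW.
    - rewrite ler_pXn2r ?nnegrE//; last 2 first.
      + exact: ltW.
      + by rewrite mulr_ge0// ltW.
      by apply: le_trans hy; rewrite lerD2l.
    - exact: hy.
  have e1 : 18^-1 * (m / (1 + m^-1) ^+ 4) * ((1 + x) / x ^+ 5 * ((1 + y) / y ^+ 5)) =
      ((1 + x) ^+ 3 * (1 + y)) * (18^-1 * m / ((1 + m^-1) ^+ 4 * y ^+ 5 * x ^+ 5 * (1 + x) ^+ 2)).
    move: (1 + m^-1) m1 => c c0.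
    by field; rewrite !gt_eqF.
  have e2 : 18^-1 * (x / (1 + x) ^+ 2) / x ^+ 6 =
      ((1 + m^-1) ^+ 4 * y ^+ 4) * (18^-1 * y / ((1 + m^-1) ^+ 4 * y ^+ 5 * x ^+ 5 * (1 + x) ^+ 2)).
    move: (1 + m^-1) m1 => c c0.
    by field; rewrite !gt_eqF.
  rewrite e1 e2; apply: ler_pM => //.
  - by rewrite mulr_ge0 ?exprn_ge0// ltW.
  - by rewrite divr_ge0 ?mulr_ge0 ?exprn_ge0// ltW.
  - rewrite ler_wpM2r//; first by rewrite invr_ge0 !mulr_ge0 ?exprn_ge0// ltW.
    by rewrite ler_wpM2l.
move=> s0 t0 mst.
have pos (x : R) : 0 < x -> 0 <= 18^-1 * (x / (1 + x) ^+ 2) / x ^+ 6.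
  move=> /ltW x0; rewrite divr_ge0 ?exprn_ge0// mulr_ge0//.
  by rewrite divr_ge0// exprn_ge0// addr_ge0.
have [st|ts] := leP s t.
  have mt : m <= t by case/orP: mst => // ms; exact: le_trans st.
  by rewrite (le_trans (key s t s0 t0 st mt))// lerDl pos.
have ms : m <= s by case/orP: mst => // mt; exact: le_trans (ltW ts).
rewrite [(1 + s) / _ * _]mulrC.
by rewrite (le_trans (key t s t0 s0 (ltW ts) ms))// lerDr pos.
Qed.

Lemma expR_profile t :
  expR (2 * profile t) = (1 + expR (t / 6)) / expR (t / 6) ^+ 5.
Proof.
have -> : 2 * profile t = ln (1 + expR (t / 6)) - 5%:R * (t / 6).
  by rewrite /profile; field.
by rewrite expRD expRN expRM_natl lnK// posrE exp61_gt0.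
Qed.

Lemma expR6 t : expR t = expR (t / 6) ^+ 6.
Proof. by rewrite -expRM_natl; congr expR; field. Qed.

End two_punctures.

Section lower_bounds.
Context {R : realType}.
Implicit Types (u w F : 'rV[R]_2 -> R) (a b p q x y : 'rV[R]_2) (i j : 'I_2).
Implicit Types (W : set 'rV[R]_2) (s t : R).

(** The boundary condition in the form in which [comparison] uses it. *)
Definition blowup W u := forall q, closure W q -> ~ W q ->
  forall M : R, \forall x \near q, W x -> M < u x.

Lemma blowup_boundary W u w q (e : R) : {for q, continuous w} ->
  (forall M : R, \forall x \near q, W x -> M < u x) -> 0 < e ->
  \forall x \near q, W x -> w x < u x + e.
Proof.
move=> cw bu e0.
have nw : \forall x \near q, w x < w q + 1.
  by move/cvgr_lt: cw; apply; rewrite ltrDl.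
apply: filterS2 nw (bu (w q + 1)) => x h1 h2 Wx.
by rewrite (lt_trans h1)// (lt_trans (h2 Wx))// ltrDl.
Qed.

Lemma sqdist_triangle a b q : sqdist a b <= 2 * (sqdist a q + sqdist b q).
Proof.
have key (x y z : R) : (y - x) ^+ 2 <= 2 * ((z - x) ^+ 2 + (z - y) ^+ 2).
  rewrite -subr_ge0; have -> : 2 * ((z - x) ^+ 2 + (z - y) ^+ 2) - (y - x) ^+ 2 =
    (2 * z - x - y) ^+ 2 by ring.
  exact: sqr_ge0.
by rewrite /sqdist addrACA mulrDr lerD.
Qed.

(** The constant [c] depends on [a] and [b] only, so that the bound is uniform along
an exhaustion. *)
Lemma two_puncture_lower a b : a != b -> exists c : R, forall W u,
  open W -> bounded_set W -> supersolution W u -> blowup W u ->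
  (forall q, closure W q -> q != a /\ q != b) ->
  forall x, W x -> profile (lnsq a x) + profile (lnsq b x) + c <= u x.
Proof.
move=> ab; have d0 : 0 < sqdist a b / 4.
  by rewrite divr_gt0// sqdist_gt0// eq_sym.
(* No point has squared distance less than [sqdist a b / 4] to both [a] and [b];
   [m] is the cube root of the corresponding distance. *)
pose m := expR (ln (sqdist a b / 4) / 6).
have m0 : 0 < m by exact: expR_gt0.
pose K : R := 18^-1 * (m / (1 + m^-1) ^+ 4).
have K0 : 0 < K.
  by rewrite /K mulr_gt0// divr_gt0// exprn_gt0// addr_gt0// invr_gt0.
exists (2^-1 * ln K) => W u oW bW su bu clab.
(* The second summand is subtracted with the opposite sign, so that
   [laplacian_sub] gives the Laplacian of [w]. *)
pose phi1 t : R := - profile t - 2^-1 * ln K.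
have dphi1 t : is_derive t 1 phi1 (- profile1 t).
  rewrite -[X in is_derive _ _ _ X]subr0.
  exact: is_deriveB (is_deriveN (is_derive_profile t)) (is_derive_cst _ _ _).
have dphi2 t : is_derive t 1 (fun t => - profile1 t) (- profile2 t).
  exact: is_deriveN (is_derive_profile1 t).
have nearT (P : R -> Prop) t : (forall t, P t) -> \forall t' \near t, P t'.
  by move=> h; near=> t'; exact: h.
pose w x := profile (lnsq a x) - phi1 (lnsq b x).
have wE x : profile (lnsq a x) + profile (lnsq b x) + 2^-1 * ln K = w x.
  by rewrite /w /phi1; ring.
have cw q : q != a -> q != b -> {for q, continuous w}.
  move=> qa qb; apply: continuousB.
    exact: (continuous_radial qa (is_derive_profile _)).
  exact: (continuous_radial qb (dphi1 _)).
have radb q : q != b -> twice_derivable (fun x => phi1 (lnsq b x)) q /\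
    laplacian (fun x => phi1 (lnsq b x)) q = 4 * - profile2 (lnsq b q) / sqdist b q.
  move=> qb; exact: (laplacian_radial qb (nearT _ _ dphi1) (dphi2 _)).
have rada q : q != a -> twice_derivable (fun x => profile (lnsq a x)) q /\
    laplacian (fun x => profile (lnsq a x)) q = 4 * profile2 (lnsq a q) / sqdist a q.
  move=> qa.
  exact: (laplacian_radial qa (nearT _ _ is_derive_profile) (is_derive_profile1 _)).
have dw q : q != a -> q != b -> twice_derivable w q /\ laplacian w q =
   4 * profile2 (lnsq a q) / sqdist a q - 4 * - profile2 (lnsq b q) / sqdist b q.
  move=> qa qb.
  have n2 : \forall y \near q, twice_derivable (fun x => profile (lnsq a x)) y /\
     twice_derivable (fun x => phi1 (lnsq b x)) y.
    apply: filterS2 (near_neq qa) (near_neq qb) => y ya yb.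
    by split; [case: (rada y ya)|case: (radb y yb)].
  have [h1 h2] := laplacian_sub n2; split; first exact: h1.
  by rewrite [LHS]h2 (rada q qa).2 (radb q qb).2.
have sw : subsolution W w.
  move=> x Wx; have [xa xb] := clab x (subset_closure Wx).
  have [tw lw] := dw x xa xb; split; [exact: cw|exact: tw|rewrite lw].
  have xa0 := sqdist_gt0 xa; have xb0 := sqdist_gt0 xb.
  have Ea : sqdist a x = expR (lnsq a x / 6) ^+ 6 by rewrite -expR6 lnK.
  have Eb : sqdist b x = expR (lnsq b x / 6) ^+ 6 by rewrite -expR6 lnK.
  have hm : (m <= expR (lnsq a x / 6)) || (m <= expR (lnsq b x / 6)).
    rewrite !ler_expR !ler_pM2r ?invr_gt0// !ler_ln ?posrE//.
    rewrite -[_ || _]negbK negb_or -!ltNge; apply/negP => /andP[h1 h2].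
    have := sqdist_triangle a b x; rewrite leNgt => /negP; apply.
    by move: h1 h2; clear; lra.
  have := two_point_ineq m0 (expR_gt0 _) (expR_gt0 _) hm; rewrite -/K.
  rewrite -!expR_profile /profile2 Ea Eb.
  have -> : expR (2 * w x) =
      K * (expR (2 * profile (lnsq a x)) * expR (2 * profile (lnsq b x))).
    rewrite -expRD -{1}(lnK K0) -expRD; congr expR.
    by rewrite -wE; move: (profile _) (profile _) (ln K) => A B C; field.
  move=> /le_trans; apply.
  by move: (expR (lnsq a x / 6)) (expR (lnsq b x / 6)) (expR_gt0 (lnsq a x / 6))
    (expR_gt0 (lnsq b x / 6)) => s t s0 t0; rewrite le_eqVlt; apply/orP; left;
   apply/eqP; field; rewrite !gt_eqF// addr_gt0.
move=> x Wx; rewrite wE; apply: (comparison oW bW su sw) Wx => q clq nWq e e0.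
have [qa qb] := clab q clq.
by apply: blowup_boundary e0; [exact: cw|exact: bu].
Unshelve. all: by end_near. Qed.

End lower_bounds.

Section logarithmic_bound.
Context {R : realType}.
Implicit Types (u w F : 'rV[R]_2 -> R) (a b p q x y : 'rV[R]_2) (i j : 'I_2).
Implicit Types (W : set 'rV[R]_2) (s t : R).

(** With [r] the distance to [a], [expR (cusp C s (lnsq a x))] is
[1 / (r * (C + s * ln r))]. For [s = -1] this is the Poincare metric of a
punctured disc around [a] with radius [expR C], for [s = 1] that of the exterior
of a disc around [a]. *)
Definition cusp (C s : R) t : R := - (t / 2) - ln (C + s * t / 2).

Definition cusp1 (C s : R) t : R := - 2^-1 - s / 2 / (C + s * t / 2).

Lemma is_derive_affine (C s t : R) : is_derive t 1 (fun x : R => C + s * x / 2) (s / 2).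
Proof. by apply: is_derive_eq; rewrite /GRing.scale/=; ring. Qed.

Lemma is_derive_cusp (C s t : R) : 0 < C + s * t / 2 ->
  is_derive t 1 (cusp C s) (cusp1 C s t).
Proof.
move=> h0.
have h2 := @is_derive1_comp R (@ln R) _ t _ _ (is_derive1_ln h0) (is_derive_affine C s t).
have h1 : is_derive t 1 (fun x : R => - (x / 2)) (- 2^-1).
  by apply: is_derive_eq; rewrite /GRing.scale/=; ring.
apply: is_derive_eq (is_deriveB h1 h2) _.
by rewrite /cusp1 [_^-1 * _]mulrC.
Qed.

Lemma is_derive_cusp1 (C s t : R) : s ^+ 2 = 1 -> 0 < C + s * t / 2 ->
  is_derive t 1 (cusp1 C s) (4^-1 / (C + s * t / 2) ^+ 2).
Proof.
move=> s1 h0; have n0 := lt0r_neq0 h0.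
have h2 := is_deriveV (f := fun x : R => C + s * x / 2) n0 (is_derive_affine C s t).
apply: is_derive_eq (is_deriveB (is_derive_cst (- 2^-1 : R) t 1)
  (is_deriveZ (s / 2) h2)) _.
rewrite /GRing.scale/=; have -> : 4^-1 = s ^+ 2 / 4 by rewrite s1 mul1r.
by move: (C + _) n0 => X X0; field.
Qed.

Lemma continuous_scaled_lnsq s a q : q != a ->
  {for q, continuous (fun x => s * lnsq a x)}.
Proof.
move=> qa.
have key (F : set_system 'rV[R]_2) : Filter F ->
    lnsq a y @[y --> F] --> lnsq a q -> s * lnsq a y @[y --> F] --> s * lnsq a q.
  by move=> FF h; apply: cvgM; [exact: cvg_cst|exact: h].
exact: (key (nbhs q) _ (continuous_lnsq qa)).
Qed.

(** The part of a domain where [r < 1], or where [r > 1], acquires boundary points on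
the circle [r = 1]; there [cusp] takes the value [- ln C], which a large [C] brings
below any bound on [u]. *)
Lemma cusp_lower W u a (C s : R) : 0 < C -> s ^+ 2 = 1 ->
  open W -> bounded_set W -> supersolution W u ->
  (forall q, closure W q -> q != a) ->
  (forall x, W x -> 0 < s * lnsq a x) ->
  (forall q, closure W q -> ~ W q ->
     (forall M : R, \forall x \near q, W x -> M < u x) \/
     [/\ {for q, continuous u}, lnsq a q = 0 & - ln C <= u q]) ->
  forall x, W x -> cusp C s (lnsq a x) <= u x.
Proof.
move=> C0 s1 oW bW su cla sW bd.
have pos t : 0 <= s * t -> 0 < C + s * t / 2.
  by move=> h; rewrite ltr_wpDr// divr_ge0.
have clpos q : closure W q -> 0 <= s * lnsq a q.
  move=> clq; rewrite leNgt; apply/negP => h.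
  have c1 := @continuous_scaled_lnsq s a q (cla q clq).
  have /clq [y [Wy /= h1]] : \forall y \near q, s * lnsq a y < 0.
    by move/cvgr_lt: c1; apply.
  by have := lt_trans (sW y Wy) h1; rewrite ltxx.
have cw q : closure W q -> {for q, continuous (fun x => cusp C s (lnsq a x))}.
  move=> clq.
  exact: (continuous_radial (cla q clq) (is_derive_cusp (pos _ (clpos q clq)))).
have sw : subsolution W (fun x => cusp C s (lnsq a x)).
  move=> x Wx; have clx := subset_closure Wx.
  have xa := cla x clx; have x0 := sqdist_gt0 xa.
  have p0 := pos _ (ltW (sW x Wx)).
  have nearpos : \forall t \near lnsq a x, 0 < C + s * t / 2.
    have dd := is_derive_affine C s (lnsq a x).
    have cc : {for lnsq a x, continuous (fun t : R => C + s * t / 2)}.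
      apply: differentiable_continuous; apply/derivable1_diffP.
      by case: dd.
    by move/cvgr_gt: cc; apply.
  have [h1 h2] := laplacian_radial xa (filterS (@is_derive_cusp C s) nearpos)
    (is_derive_cusp1 s1 p0).
  split; [exact: cw|exact: h1|rewrite h2 le_eqVlt; apply/orP; left; apply/eqP].
  have -> : 2 * cusp C s (lnsq a x) =
      - lnsq a x - (ln (C + s * lnsq a x / 2) + ln (C + s * lnsq a x / 2)).
    by rewrite /cusp; move: (ln (C + _)) => l; field.
  rewrite expRD !expRN expRD !lnK ?posrE//.
  move: (C + _) p0 => X X0.
  by field; rewrite !gt_eqF.
apply: (comparison oW bW su sw) => q clq nWq e e0.
have [bu|[cu q0 uq]] := bd q clq nWq.
  by apply: blowup_boundary e0; [exact: cw|exact: bu].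
have e2 : 0 < e / 2 by rewrite divr_gt0.
have E0 : cusp C s (lnsq a q) = - ln C.
  by rewrite /cusp q0 mulr0 mul0r oppr0 addr0 sub0r.
have n1 : \forall x \near q, cusp C s (lnsq a x) < - ln C + e / 2.
  move/cvgr_lt: (cw q clq); apply; rewrite E0 ltrDl//.
have n2 : \forall x \near q, - ln C - e / 2 < u x.
  by move/cvgr_gt: cu; apply; rewrite ltrBlDr (le_lt_trans uq)// ltrDl.
apply: filterS2 n1 n2 => x h1 h2 _; rewrite (lt_trans h1)// -ltrBlDr.
apply: le_lt_trans h2; rewrite le_eqVlt; apply/orP; left; apply/eqP.
by move: (ln C) => l; field.
Qed.

(** [two_puncture_lower] bounds [u] on the unit circle around [a], and [cusp_lower]
carries this bound to both sides of the circle. *)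
Lemma log_bound a b : a != b -> exists2 C : R, 1 <= C & forall W u,
  open W -> bounded_set W -> supersolution W u -> blowup W u ->
  (forall q, closure W q -> q != a /\ q != b) ->
  forall x, W x -> - (lnsq a x / 2) - ln (C + `|lnsq a x| / 2) <= u x.
Proof.
move=> ab; have [c Hc] := two_puncture_lower ab.
(* On the unit circle [sqdist b x <= 2 * (1 + sqdist a b)], so that [- l] is a lower
   bound there. *)
pose l := 5 / 12 * ln (2 * (1 + sqdist a b)) - c.
exists (expR `|l|); first by rewrite -expR0 ler_expR.
set C := expR _; have C0 : 0 < C by exact: expR_gt0.
move=> W u oW bW su bu clab.
have circle x : W x -> lnsq a x = 0 -> - ln C <= u x.
  move=> Wx x0; apply: le_trans (Hc W u oW bW su bu clab x Wx).
  have [xa xb] := clab x (subset_closure Wx).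
  have s1 : sqdist a x = 1.
    by have := lnK (sqdist_gt0 xa); rewrite -/(lnsq a x) x0 expR0.
  have p0 t : 0 <= ln (1 + expR (t / 6)).
    by apply: ln_ge0; rewrite lerDl expR_ge0.
  have lb : lnsq b x <= ln (2 * (1 + sqdist a b)).
    rewrite ler_ln ?posrE ?sqdist_gt0//; last first.
      by rewrite mulr_gt0// ltr_wpDr// sqdist_ge0.
    have -> : 2 * (1 + sqdist a b) = 2 * (sqdist a x + sqdist a b) by rewrite s1.
    apply: le_trans (sqdist_triangle b x a) _.
    rewrite /sqdist; move: (b 0 0) (b 0 1) (a 0 0) (a 0 1) (x 0 0) (x 0 1) => *.
    by rewrite le_eqVlt; apply/orP; left; apply/eqP; ring.
  have h1 := p0 0; have h2 := p0 (lnsq b x).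
  have h3 : 5 / 12 * ln (2 * (1 + sqdist a b)) - c <= `|l| := ler_norm l.
  rewrite /C expRK /profile x0; move: h1 h2 h3 lb.
  move: (ln (1 + expR (0 / 6))) (ln (1 + expR (lnsq b x / 6))) (lnsq b x)
    (ln (2 * _)) `|l|; clear; move=> A B L D E.
  by move=> *; lra.
move=> x Wx.
have [x0|x0] := eqVneq (lnsq a x) 0.
  by rewrite x0 normr0 mul0r oppr0 addr0 sub0r; exact: circle.
have main (s : R) : s ^+ 2 = 1 -> 0 < s * lnsq a x -> cusp C s (lnsq a x) <= u x.
  move=> s1 sx.
  pose W' := [set y | W y /\ 0 < s * lnsq a y].
  have sub : W' `<=` W by move=> y [].
  have cs q := @continuous_scaled_lnsq s a q.
  apply: (@cusp_lower W' u a C s) => //.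
  - rewrite openE => y [Wy y0] /=; apply: filterI.
      by apply: open_nbhs_nbhs.
    by move/cvgr_gt: (cs y (clab y (subset_closure Wy)).1); apply.
  - by apply: (sub_boundedr _ bW) => A AW y [/AW].
  - by move=> y [Wy _]; exact: su.
  - by move=> q /(closure_subset sub) /clab [].
  - by move=> y [].
  - move=> q clq nWq; have clq' := closure_subset sub clq.
    have [qa qb] := clab q clq'.
    have [Wq|nq] := pselect (W q); last first.
      by left => M; apply: filterS (bu q clq' nq M) => y h [Wy _]; exact: h.
    have q0 : lnsq a q = 0.
      apply: contrapT => /eqP q0.
      have [h|h] := ltP 0 (s * lnsq a q); first exact: nWq.
      have {}h : s * lnsq a q < 0.
        rewrite lt_neqAle h andbT mulf_neq0//.
        by apply: contra_eq_neq s1 => ->; rewrite expr0n eq_sym oner_neq0.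
      have /clq [y [[_ h1] /= h2]] : \forall y \near q, s * lnsq a y < 0.
        by move/cvgr_lt: (cs q qa); apply.
      by have := lt_trans h1 h2; rewrite ltxx.
    by right; split; [have [] := su q Wq|exact: q0|exact: circle].
have [xp|xn] := ltP 0 (lnsq a x).
  have := main 1 _ _; rewrite /cusp !mul1r (gtr0_norm xp).
  by apply; rewrite ?expr1n.
have {}xn : lnsq a x < 0 by rewrite lt_neqAle x0.
have := main (-1) _ _; rewrite /cusp !mulN1r (ltr0_norm xn).
by apply; rewrite ?sqrrN ?expr1n// oppr_gt0.
Qed.

End logarithmic_bound.

(** * The decreasing limit *)

Section decreasing_solutions.
Context {R : realType}.
Implicit Types (u w F : 'rV[R]_2 -> R) (a b p q x y : 'rV[R]_2) (i j : 'I_2).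
Implicit Types (W Om : set 'rV[R]_2) (Omn : nat -> set 'rV[R]_2).
Implicit Types (un : nat -> 'rV[R]_2 -> R).

Lemma boundary_blowupP W u : open W -> boundary_blowup W u -> blowup W u.
Proof.
move=> oW bu q clq nWq M; have [e e0 H] := bu M.
apply/near_normP; exists e => // x xe Wx; apply: (H x q Wx) xe.
by split=> //; apply: contra_not nWq; exact: interior_subset.
Qed.

(** Move along the first coordinate, then along the second. *)
Lemma lipschitz_ball u p (r B : R) : 
  (forall x i, `|x - p| < r -> derivable u x (delta_mx 0 i)) ->
  (forall x i, `|x - p| < r -> `|pderiv i u x| <= B) ->
  forall x, `|x - p| < r -> `|u x - u p| <= 2 * B * `|x - p|.
Proof.
move=> du dB x xr; have r0 : 0 < r := le_lt_trans (normr_ge0 _) xr.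
have B0 : 0 <= B.
  by apply: le_trans (dB p 0 _); rewrite ?normr_ge0// subrr normr0.
pose h i := (x - p) 0 i.
have hx i : `|h i| <= `|x - p| by exact: coord_le_norm.
have xE : x = p + h 0 *: delta_mx 0 0 + h 1 *: delta_mx 0 1.
  apply/rowP => k; rewrite /h !mxE.
  by case: (ord2P k) => -> /=; ring.
have inb (s t : R) : `|s| <= `|h 0| -> `|t| <= `|h 1| ->
    `|p + s *: delta_mx 0 0 + t *: delta_mx 0 1 - p| < r.
  move=> sh th; apply: le_lt_trans xr; apply: norm_le_coord; first exact: normr_ge0.
  move=> k; rewrite !mxE; case: (ord2P k) => -> /=.
    by rewrite !(mulr0, mulr1, addr0) addrC addKr (le_trans sh).
  by rewrite !(mulr0, mulr1, addr0) addrC addKr (le_trans th).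
have inb0 (s : R) : `|s| <= `|h 0| -> `|p + s *: delta_mx 0 0 - p| < r.
  move=> sh; have := inb s 0 sh; rewrite scale0r addr0; apply.
  by rewrite normr0.
have [s sh E0] := @mvt_line R u p (delta_mx 0 0) (h 0) (fun s sh => du _ 0 (inb0 s sh)).
have [t th E1] := @mvt_line R u (p + h 0 *: delta_mx 0 0) (delta_mx 0 1) (h 1)
  (fun t th => du _ 1 (inb (h 0) t (lexx _) th)).
have d0 := dB _ 0 (inb0 s sh).
have d1 := dB _ 1 (inb (h 0) t (lexx _) th).
rewrite {1}xE -(subrKA (u (p + h 0 *: delta_mx 0 0))) E1 E0.
rewrite (le_trans (ler_normD _ _))// !normrM.
have -> : 2 * B * `|x - p| = B * `|x - p| + B * `|x - p| by ring.
by rewrite lerD// ler_pM.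
Qed.

Lemma exhausted_by_compact Om Omn : open Om -> (forall n, Omn n `<=` Om) ->
  (forall K : set 'rV[R]_2, compact K -> K `<=` Om ->
     exists N : nat, forall n : nat, (N <= n)%N -> K `<=` Omn n) ->
  exhausted_by Omn Om.
Proof.
move=> oOm sub ex; split=> // p Omp.
have /near_normP [r r0 H] : \forall x \near p, Om x by apply: open_nbhs_nbhs.
have [|N HN] := ex _ (@compact_norm_ball R p (r / 2)).
  by move=> x /= xr; apply: H; rewrite (le_lt_trans xr)// ltr_pdivrMr// ltr_pMr// ltr1n.
exists (r / 2); first by rewrite divr_gt0.
by exists N => n x Nn xr; apply: (HN n Nn); exact: ltW.
Qed.

Definition solution W u := smooth_on W u /\
  forall p, W p -> laplacian u p = expR (2 * u p).

Lemma solution_super W u : solution W u -> supersolution W u.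
Proof.
move=> [su eu] x Wx; split; last by rewrite eu.
  exact: smooth_continuous su Wx.
exact: smooth_twice su Wx.
Qed.

Lemma solution_decreasing W V u w : open W -> bounded_set W -> closure W `<=` V ->
  solution W u -> blowup W u -> solution V w -> forall x, W x -> w x <= u x.
Proof.
move=> oW bW clW su bu [sw ew].
have sub x : W x -> V x by move=> Wx; exact/clW/subset_closure.
apply: (comparison oW bW (solution_super su)).
  move=> x /sub Vx; split; last by rewrite ew.
    exact: smooth_continuous sw Vx.
  exact: smooth_twice sw Vx.
move=> q clq nWq e e0; apply: blowup_boundary e0; last exact: bu.
exact: smooth_continuous sw (clW q clq).
Qed.

Lemma exists_mul_lt (k r : R) : 0 < k -> 0 < r ->
  exists2 d : R, 0 < d & k * d < r.
Proof.
move=> k0 r0; exists (r / k / 2); first by rewrite !divr_gt0.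
have -> : k * (r / k / 2) = r / 2 by field; exact: lt0r_neq0.
by rewrite ltr_pdivrMr// ltr_pMr// ltr1n.
Qed.

Section limit.
Variables (Om : set 'rV[R]_2) (Omn : nat -> set 'rV[R]_2).
Variable un : nat -> 'rV[R]_2 -> R.
Hypothesis ex : exhausted_by Omn Om.
Hypothesis Omn_open : forall n, open (Omn n).
Hypothesis Omn_nested : forall n, closure (Omn n) `<=` Omn n.+1.
Hypothesis un_sol : forall n, solution (Omn n) (un n).
Hypothesis un_dec : forall n p, Omn n p -> un n.+1 p <= un n p.
Variable w : 'rV[R]_2 -> R.
Hypothesis w_cont : forall p, Om p -> {for p, continuous w}.
Hypothesis w_lower : forall n p, Omn n p -> w p <= un n p.

Lemma Omn_mono n m p : (n <= m)%N -> Omn n p -> Omn m p.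
Proof.
move=> /subnK <-; elim: (m - n)%N => [//|k IH] Onp.
by apply: Omn_nested; apply: subset_closure; exact: IH.
Qed.

Lemma un_mono n m p : (n <= m)%N -> Omn n p -> un m p <= un n p.
Proof.
move=> /subnK <-; elim: (m - n)%N => [//|k IH] Onp.
apply: le_trans (IH Onp); apply: un_dec.
by apply: Omn_mono Onp; rewrite leq_addl.
Qed.

Lemma un_pointwise_cvg p : Om p -> cvgn (un ^~ p).
Proof.
move=> Omp; have [r r0 [N H]] := exhausted_nbhs ex Omp.
have Onp n : (N <= n)%N -> Omn n p.
  by move=> Nn; apply: (H n p Nn _).1; rewrite subrr normr0.
apply: (@near_nonincreasing_is_cvgn _ _ (w p)).
  by exists N => // n /= Nn m nm; apply: un_mono => //; exact: Onp.
by exists N => // n /= Nn; apply: w_lower; exact: Onp.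
Qed.

Lemma un_locally_bounded p : Om p -> exists2 r : R, 0 < r &
  exists N : nat, exists M : R, forall n x, (N <= n)%N -> `|x - p| < r ->
    Omn n x /\ `|un n x| <= M.
Proof.
move=> Omp; have [r r0 [N H]] := exhausted_nbhs ex Omp.
have pr : `|p - p| < r by rewrite subrr normr0.
have ONp := (H N p (leqnn N) pr).1.
have cN : {for p, continuous (un N)}.
  by have [sN _] := un_sol N; exact: smooth_continuous sN ONp.
have [s s0 Hs] := continuous_norm cN ltr01.
have [t t0 Ht] := continuous_norm (w_cont Omp) ltr01.
have [d d0 [dr dst]] : exists2 d : R, 0 < d & d < r /\ d < s /\ d < t.
  have [d1 d10 [d1s d1t]] := exists_lt_both s0 t0.
  have [d d0 [dr dd1]] := exists_lt_both r0 d10.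
  by exists d => //; split=> //; split; exact: lt_trans dd1 _.
exists d => //; exists N; exists (`|un N p| + `|w p| + 1) => n x Nn xd.
have Onx := (H n x Nn (lt_trans xd dr)).1.
have ONx := (H N x (leqnn N) (lt_trans xd dr)).1.
split; first exact: Onx.
have h1 := Hs x (lt_trans xd dst.1); have h2 := Ht x (lt_trans xd dst.2).
have h3 := un_mono Nn ONx; have h4 := w_lower Onx.
have h5 := ler_norm (un N p); have h6 := ler_norm (- w p).
have h7 := normr_ge0 (un N p); have h8 := normr_ge0 (w p).
rewrite normrN in h6.
move: h1 h2 h3 h4 h5 h6 h7 h8; rewrite !ltr_norml ler_norml.
move: (un n x) (un N x) (un N p) (w x) (w p) `|un N p| `|w p|; clear.
by move=> A B C D E F G /andP[h1 h1'] /andP[h2 h2'] h3 h4 h5 h6 h7 h8; apply/andP; split; lra.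
Qed.

(** Pointwise convergence at [p] becomes continuous because the gradient estimate
gives the [un n] a common Lipschitz constant near [p]. *)
Lemma un_ccvg : ccvg Om un (fun p => lim (un ^~ p @ \oo)).
Proof.
apply/ccvgP => p Omp e e0.
have [r r0 [N [M H]]] := un_locally_bounded Omp.
have [d d0 d4] : exists2 d : R, 0 < d & 4 * d < r by exact: exists_mul_lt.
pose B := 2 * M / d + (expR (2 * M) + 1) * d / 2.
have grad n x i : (N <= n)%N -> `|x - p| < d -> `|pderiv i (un n) x| <= B.
  move=> Nn xd; have dd : d < 2 * d by rewrite ltr_pMl// ltr1n.
  apply: (gradient_estimate (r := 2 * d) i d0 dd) => y yx.
  have yr : `|y - p| < r.
    have -> : y - p = (y - x) + (x - p) by rewrite addrA subrK.
    rewrite (le_lt_trans (ler_normD _ _))// (lt_trans (ltrD yx xd))//.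
    rewrite -[X in 2 * d + X]mul1r -mulrDl (lt_trans _ d4)// ltr_pM2r//.
    by rewrite (_ : 2 + 1 = 3%:R) ?ltr_nat//; ring.
  have [Ony My] := H n y Nn yr; have [sn en] := un_sol n.
  split.
  - exact: smooth_continuous sn Ony.
  - exact: smooth_twice sn Ony.
  - exact: My.
  - rewrite en// ger0_norm ?expR_ge0//.
    rewrite (@le_lt_trans _ _ (expR (2 * M)))// ?ltrDl// ler_expR.
    by rewrite ler_pM2l// (le_trans (ler_norm _)).
have dr : d < r by apply: le_lt_trans d4; rewrite ler_peMl ?ler1n// ltW.
have lip n x : (N <= n)%N -> `|x - p| < d -> `|un n x - un n p| <= 2 * B * `|x - p|.
  move=> Nn; apply: lipschitz_ball.
    move=> y i yd; have [Ony _] := H n y Nn (lt_trans yd dr).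
    have [sn _] := un_sol n; exact: smooth_derivable sn Ony.
  by move=> y i yd; exact: grad.
have B0 : 0 <= B.
  by apply: le_trans (grad N p 0 (leqnn N) _); rewrite ?normr_ge0// subrr normr0.
have e2 : 0 < e / 2 by rewrite divr_gt0.
have [N' _ HN'] := (cvgrPdist_lt _ _).1 (un_pointwise_cvg Omp) _ e2.
have B1 : 0 < 2 * B + 1 by rewrite ltr_wpDl// mulr_ge0.
have r1 : 0 < e / 2 / (2 * B + 1) by rewrite divr_gt0.
have [t t0 [td tr]] := exists_lt_both d0 r1.
exists t => //; exists (maxn N N') => n x; rewrite geq_max => /andP[Nn Nn'] xt.
have h1 := HN' n Nn'; have h2 := lip n x Nn (lt_trans xt td).
rewrite -(subrKA (un n p)) (le_lt_trans (ler_normD _ _))//.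
rewrite (splitr e) ltr_leD// distrC (le_trans h2)//.
rewrite -[leRHS](divfK (lt0r_neq0 B1)) [leRHS]mulrC.
rewrite ler_pM//; first by rewrite mulr_ge0.
  by rewrite lerDl.
exact: ltW (lt_trans xt tr).
Qed.

(** By the equation, convergence of [un] in C^k is convergence of its Laplacian in
C^k, and [Ck_elliptic] gains one order. *)
Lemma limit_smooth (u := fun p => lim (un ^~ p @ \oo)) :
  forall k, Ck_cvg Omn Om k un u.
Proof.
elim=> [|k IH]; first by split => //; exact: un_ccvg.
apply: (Ck_elliptic (H := fun x => expR (2 * u x)) ex Omn_open) => //.
  by move=> n; case: (un_sol n).
apply: (Ck_ext ex Omn_open) (Ck_exp2 ex Omn_open IH) => //.
by move=> n x Onx; have [_ ->] := un_sol n.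
Qed.

End limit.

End decreasing_solutions.

(** * Conformal metrics *)

Section conformal_metric.
Context {R : realType}.
Implicit Types (u : 'rV[R]_2 -> R) (p q x y : 'rV[R]_2) (i j k l m : 'I_2).
Implicit Types W : set 'rV[R]_2.

Lemma conformal_coef u p i j :
  conformal u p i j = (i == j)%:R * expR (2 * u p).
Proof. by rewrite /conformal mxE [RHS]mulr_natl. Qed.

Lemma pderiv_conformal u p i j k : derivable u p (delta_mx 0 k) ->
  pderiv k (fun q => conformal u q i j) p =
  (i == j)%:R * (2 * expR (2 * u p) * pderiv k u p).
Proof.
move=> du.
have -> : (fun q => conformal u q i j) = (fun q => (i == j)%:R * expR (2 * u q)).
  by apply/funext => q; exact: conformal_coef.
by have [_ E] := is_deriveZ ((i == j)%:R : R) (is_derive_exp2 du); rewrite [LHS]E.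
Qed.

Lemma christoffel_conformal u p l i j :
  (forall k, derivable u p (delta_mx 0 k)) ->
  christoffel (conformal u) l i j p =
  (l == j)%:R * pderiv i u p + (l == i)%:R * pderiv j u p
  - (i == j)%:R * pderiv l u p.
Proof.
move=> du; rewrite /christoffel big_ord2 !pderiv_conformal// /conformal.
rewrite invmx_scalar !mxE.
have : expR (2 * u p) != 0 by rewrite gt_eqF// expR_gt0.
move: (expR (2 * u p)) => e e0.
case: (ord2P l) => ->; case: (ord2P i) => ->; case: (ord2P j) => -> /=;
  rewrite ?mulr1n ?mulr0n; move: (pderiv 0 u p) (pderiv 1 u p) => A B; by field.
Qed.

Lemma pderiv_christoffel_conformal W u p k l i j : open W -> smooth_on W u -> W p ->
  pderiv k (christoffel (conformal u) l i j) p =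
  (l == j)%:R * pderiv k (pderiv i u) p + (l == i)%:R * pderiv k (pderiv j u) p
  - (i == j)%:R * pderiv k (pderiv l u) p.
Proof.
move=> oW su Wp.
have d2 n : is_derive p (delta_mx 0 k) (pderiv n u) (pderiv k (pderiv n u) p).
  apply: derivableP.
  exact: smooth_derivable (smooth_pderiv n su) Wp.
have [_ E] := is_deriveB (is_deriveD (is_deriveZ ((l == j)%:R : R) (d2 i))
  (is_deriveZ ((l == i)%:R : R) (d2 j))) (is_deriveZ ((i == j)%:R : R) (d2 l)).
rewrite -[RHS]E; apply: (pderiv_eq_on _ oW _ Wp) => q Wq.
by apply: christoffel_conformal => n; exact: smooth_derivable su Wq.
Qed.

(** The terms quadratic in the gradient of [u] cancel. *)
Lemma gauss_curvature_conformal W u p : open W -> smooth_on W u -> W p ->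
  gauss_curvature (conformal u) p = - laplacian u p / expR (2 * u p).
Proof.
move=> oW su Wp.
have du k : derivable u p (delta_mx 0 k) by exact: smooth_derivable su Wp.
rewrite /gauss_curvature /riemann_curv !big_ord2 !conformal_coef.
rewrite /conformal det_scalar !(pderiv_christoffel_conformal _ _ _ _ oW su Wp).
rewrite !christoffel_conformal// laplacianE /=.
have : expR (2 * u p) != 0 by rewrite gt_eqF// expR_gt0.
move: (expR (2 * u p)) (pderiv 0 (pderiv 0 u) p) (pderiv 1 (pderiv 1 u) p)
  (pderiv 0 (pderiv 1 u) p) (pderiv 1 (pderiv 0 u) p)
  (pderiv 0 u p) (pderiv 1 u p) => e A B A' B' C D e0.
by field.
Qed.

Lemma gnorm2_conformal u p v :
  gnorm2 (conformal u) p v = expR (2 * u p) * (v 0 0 ^+ 2 + v 0 1 ^+ 2).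
Proof.
rewrite /gnorm2 /conformal mul_mx_scalar -scalemxAl !mxE; congr (_ * _).
by rewrite big_ord2 !mxE.
Qed.

Lemma metric_tensor_conformal W u : open W ->
  smooth_on W (fun p => expR (2 * u p)) -> metric_tensor W (conformal u).
Proof.
move=> oW se; split=> [i j|p Wp].
  have [->|ij] := eqVneq i j.
    have -> : (fun p => conformal u p j j) = (fun p => expR (2 * u p)).
      by apply/funext => p; rewrite conformal_coef eqxx mul1r.
    exact: se.
  have -> : (fun p => conformal u p i j) = cst 0.
    by apply/funext => p; rewrite conformal_coef (negbTE ij) mul0r.
  have h s : iter_pderiv s (cst 0 : 'rV[R]_2 -> R) = cst 0.
    elim: s => [//|k s IH]; rewrite /iter_pderiv /= -/(iter_pderiv s _) IH.
    by apply/funext => q; rewrite /pderiv derive_cst.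
  move=> s p _; rewrite h; split; first exact: cst_continuous.
  by move=> k; exact: derivable_cst.
split; first by rewrite /conformal tr_scalar_mx.
move=> v v0; rewrite gnorm2_conformal mulr_gt0 ?expR_gt0//.
have := @sqdist_gt0 R 0 v v0.
by rewrite /sqdist !mxE !subr0.
Qed.

End conformal_metric.

(** * Length of arcs and distance *)

Section arcs.
Context {R : realType}.
Implicit Types (u : 'rV[R]_2 -> R) (a p q x y : 'rV[R]_2) (i j : 'I_2).
Implicit Types (W : set 'rV[R]_2) (c : R -> 'rV[R]_2).

Lemma continuous01_measurable (f : R -> R) :
  (forall t : R, 0 <= t <= 1 -> {for t, continuous f}) ->
  measurable_fun (`[0%R, 1%R] : set R) (EFin \o f).
Proof.
move=> cf; apply/measurable_EFinP; apply: subspace_continuous_measurable_fun => //.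
by apply: continuous_in_subspaceT => t /[!inE]/= /[!in_itv]/= /cf.
Qed.

Lemma total_variation_le (h dh sp : R -> R) :
  (forall t : R, 0 <= t <= 1 -> is_derive t 1 h (dh t)) ->
  (forall t : R, 0 <= t <= 1 -> {for t, continuous dh}) ->
  (forall t : R, 0 <= t <= 1 -> {for t, continuous sp}) ->
  (forall t : R, 0 <= t <= 1 -> `|dh t| <= sp t) ->
  ((`|h 1 - h 0|)%:E <=
     \int[lebesgue_measure]_(t in `[0%R, 1%R]) (sp t)%:E)%E.
Proof.
move=> hd cdh csp le.
have ch (t : R) : 0 <= t <= 1 -> {for t, continuous h}.
  move=> /hd[d _]; apply: differentiable_continuous; exact/derivable1_diffP.
have itvP (t : R) : t \in `]0%R, 1%R[ -> 0 <= t <= 1.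
  by rewrite in_itv/= => /andP[/ltW -> /ltW ->].
have ftc : (\int[lebesgue_measure]_(t in `[0%R, 1%R]) (dh t)%:E = (h 1)%:E - (h 0)%:E)%E.
  apply: continuous_FTC2 => //.
  - by apply: continuous_in_subspaceT => t /[!inE]/= /[!in_itv]/= /cdh.
  - split.
    + by move=> t /itvP /hd [].
    + by apply: cvg_at_right_filter; apply: ch; rewrite lexx ler01.
    + by apply: cvg_at_left_filter; apply: ch; rewrite lexx ler01.
  - by move=> t /itvP /hd [_ E]; rewrite derive1E.
have mdh := continuous01_measurable cdh.
have -> : (`|h 1 - h 0|%:E = `|\int[lebesgue_measure]_(t in `[0%R, 1%R]) (dh t)%:E|)%E.
  by rewrite ftc -EFinB.
have m01 : measurable (`[0%R, 1%R] : set R) by exact: measurable_itv.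
have le1 := le_abse_integral (@lebesgue_measure R) m01 mdh.
apply: le_trans le1 _.
apply: ge0_le_integral.
- exact: m01.
- by move=> t _ /=; rewrite lee_fin.
- exact: (measurableT_comp (@abse_measurable R setT) mdh).
- exact: continuous01_measurable.
- by move=> t /=; rewrite in_itv/= => /le h'; rewrite lee_fin.
Qed.

Definition speed u c t : R := Num.sqrt (gnorm2 (conformal u) (c t) (derive1 c t)).

Lemma is_derive_arc c t i : derivable c t 1 ->
  is_derive t 1 (fun s => c s 0 i) (derive1 c t 0 i).
Proof.
move=> dc; have /derivable_mxP/(_ 0 i) d := dc.
split; first exact: d.
by rewrite derive1E derive_mx// mxE.
Qed.

Lemma continuous_arc c t : derivable c t 1 -> {for t, continuous c}.
Proof. by move=> dc; apply: differentiable_continuous; exact/derivable1_diffP. Qed.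

Lemma continuous_derive_arc c t i : continuous (derive1 c) ->
  {for t, continuous (fun s => derive1 c s 0 i)}.
Proof.
move=> dc; apply: (@continuous_comp _ _ _ (derive1 c) (fun x : 'rV[R]_2 => x 0 i)).
  exact: dc.
exact: continuous_coord.
Qed.

Lemma continuous_speed W u c t : C1_arc W c ->
  (forall x, W x -> {for x, continuous u}) ->
  0 <= t <= 1 -> {for t, continuous (speed u c)}.
Proof.
move=> [dc cdc Wc] cu t01.
have -> : speed u c = (fun t => Num.sqrt (expR (2 * u (c t)) *
    (derive1 c t 0 0 ^+ 2 + derive1 c t 0 1 ^+ 2))).
  by apply/funext => s; rewrite /speed gnorm2_conformal.
apply: continuous_comp; last exact: sqrt_continuous.
have cuc : {for t, continuous (fun t => u (c t))}.
  apply: (@continuous_comp _ _ _ c u); first exact: continuous_arc.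
  exact/cu/Wc.
apply: continuousM.
  apply: continuous_comp; last exact: continuous_expR.
  by apply: continuousM; [exact: cst_continuous|exact: cuc].
by apply: continuousD; (apply: continuousM; exact: continuous_derive_arc).
Qed.

Lemma arc_length_ge W u c (h dh : R -> R) : C1_arc W c ->
  (forall x, W x -> {for x, continuous u}) ->
  (forall t : R, 0 <= t <= 1 -> is_derive t 1 h (dh t)) ->
  (forall t : R, 0 <= t <= 1 -> {for t, continuous dh}) ->
  (forall t : R, 0 <= t <= 1 -> `|dh t| <= speed u c t) ->
  (`|h 1 - h 0|%:E <= arc_length (conformal u) c)%E.
Proof.
move=> ac cu dh1 dh2 dh3; apply: (total_variation_le dh1 dh2) => //.
by move=> t t01; exact: continuous_speed ac cu t01.
Qed.

Lemma arc_length_le W u c (B : R) : C1_arc W c ->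
  (forall x, W x -> {for x, continuous u}) ->
  (forall t : R, 0 <= t <= 1 -> speed u c t <= B) ->
  (arc_length (conformal u) c <= B%:E)%E.
Proof.
move=> ac cu leB.
have m1 : measurable_fun (`[0%R, 1%R] : set R) (fun t => (speed u c t)%:E).
  by apply: continuous01_measurable => t t01; exact: continuous_speed ac cu t01.
have -> : (B%:E = \int[lebesgue_measure]_(t in `[0%R, 1%R]) (cst B%:E t))%E.
  rewrite integral_cst//= lebesgue_measure_itv/= lte_fin ltr01.
  by rewrite oppr0 adde0 mule1.
apply: ge0_le_integral.
- exact: measurable_itv.
- by move=> t _; rewrite lee_fin sqrtr_ge0.
- exact: m1.
- exact: measurable_cst.
- by move=> t /=; rewrite in_itv/= => /leB h; rewrite lee_fin.
Qed.

(** The exhaustion of the plane without [a] that is Lipschitz for a metric bounded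
below by [1 / (r * (C + `|ln r|))], with [r] the distance to [a]. The primitive of
this density grows like [ln `|ln r|]; squaring the logarithm makes it smooth at
[r = 1]. *)
Definition height (kap : R) a x : R := kap * ln (1 + lnsq a x ^+ 2).

Definition height1 (kap : R) a x i : R :=
  kap * (2 * lnsq a x / (1 + lnsq a x ^+ 2)) * (2 * (x 0 i - a 0 i) / sqdist a x).

Lemma is_derive_height kap a c t : derivable c t 1 -> c t != a ->
  is_derive t 1 (fun s => height kap a (c s))
    (height1 kap a (c t) 0 * derive1 c t 0 0 + height1 kap a (c t) 1 * derive1 c t 0 1).
Proof.
move=> dc ca; have s0 := sqdist_gt0 ca.
have d0 := is_derive_arc 0 dc; have d1 := is_derive_arc 1 dc.
have dN : is_derive t 1 (fun s => sqdist a (c s))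
   (2 * (c t 0 0 - a 0 0) * derive1 c t 0 0 + 2 * (c t 0 1 - a 0 1) * derive1 c t 0 1).
  have e0 := is_deriveB d0 (is_derive_cst (a 0 0) t 1).
  have e1 := is_deriveB d1 (is_derive_cst (a 0 1) t 1).
  apply: is_derive_eq (is_deriveD (is_deriveM e0 e0) (is_deriveM e1 e1)) _.
  by rewrite /GRing.scale/= !fctE; ring.
have dL := @is_derive1_comp R (@ln R) (fun s => sqdist a (c s)) t _ _ (is_derive1_ln s0) dN.
have p0 : 0 < 1 + lnsq a (c t) ^+ 2 by rewrite ltr_wpDr// sqr_ge0.
have dS : is_derive t 1 (fun s => 1 + lnsq a (c s) ^+ 2) _ :=
  is_deriveD (is_derive_cst (1 : R) t 1) (is_deriveM dL dL).
have dln := @is_derive1_comp R (@ln R) _ t _ _ (is_derive1_ln p0) dS.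
apply: is_derive_eq (is_deriveZ kap dln) _.
rewrite /GRing.scale/= /height1 -/(lnsq a (c t)).
have n1 := lt0r_neq0 p0; have n2 := lt0r_neq0 s0.
move: (lnsq a (c t)) (sqdist a (c t)) (derive1 c t 0 0) (derive1 c t 0 1) n1 n2 => T N v0 v1 n1 n2.
by field; rewrite n1 n2.
Qed.

End arcs.

Section riemannian_distance.
Context {R : realType}.
Implicit Types (u : 'rV[R]_2 -> R) (a p q x y : 'rV[R]_2) (i j : 'I_2).
Implicit Types (W : set 'rV[R]_2) (c : R -> 'rV[R]_2).

Lemma continuous_height1 kap a q i : q != a ->
  {for q, continuous (fun x => height1 kap a x i)}.
Proof.
move=> qa; have s0 := sqdist_gt0 qa.
have key (F : set_system 'rV[R]_2) : Filter F ->
    lnsq a y @[y --> F] --> lnsq a q -> sqdist a y @[y --> F] --> sqdist a q ->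
    y 0 i @[y --> F] --> q 0 i ->
    height1 kap a y i @[y --> F] --> height1 kap a q i.
  move=> FF FL FN Fi.
  have p0 : 1 + lnsq a q ^+ 2 != 0.
    by apply: lt0r_neq0; rewrite ltr_wpDr// sqr_ge0.
  apply: cvgM; [apply: cvgM|apply: cvgM].
  - exact: cvg_cst.
  - apply: cvgM; first by apply: cvgM; [exact: cvg_cst|exact: FL].
    apply: cvgV; first exact: p0.
    by apply: cvgD; [exact: cvg_cst|apply: cvgM; exact: FL].
  - by apply: cvgM; [exact: cvg_cst|apply: cvgB; [exact: Fi|exact: cvg_cst]].
  - by apply: cvgV; [exact: lt0r_neq0|exact: FN].
exact: (key (nbhs q) _ (continuous_lnsq qa) (@continuous_sqdist R a q)
  (@continuous_coord R i q)).
Qed.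

(** Cauchy-Schwarz reduces the claim to a bound on the gradient of [height]; the
factor [(8 * C)^-1] is what makes that gradient at most the density
[1 / (r * (C + `|T| / 2))], with [T = ln (r ^+ 2)]. *)
Lemma height1_bound (C T N X Y v0 v1 U : R) : 1 <= C -> 0 < N -> N = X ^+ 2 + Y ^+ 2 ->
  1 <= expR U * (N * (C + `|T| / 2) ^+ 2) ->
  `|(8 * C)^-1 * (2 * T / (1 + T ^+ 2)) * (2 * X / N) * v0
    + (8 * C)^-1 * (2 * T / (1 + T ^+ 2)) * (2 * Y / N) * v1|
    <= Num.sqrt (expR U * (v0 ^+ 2 + v1 ^+ 2)).
Proof.
move=> C1 N0 NE hU.
have C0 : 0 < C by exact: lt_le_trans C1.
have T0 : 0 < 1 + T ^+ 2 by rewrite ltr_wpDr// sqr_ge0.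
have D0 : 0 < C + `|T| / 2 by rewrite ltr_wpDr// divr_ge0.
rewrite -sqrtr_sqr ler_sqrt; last first.
  by rewrite mulr_ge0 ?expR_ge0// addr_ge0 ?sqr_ge0.
set g := (8 * C)^-1 * (2 * T / (1 + T ^+ 2)).
have -> : (g * (2 * X / N) * v0 + g * (2 * Y / N) * v1) ^+ 2 =
    (2 * g / N) ^+ 2 * (X * v0 + Y * v1) ^+ 2 by ring.
have CS : (X * v0 + Y * v1) ^+ 2 <= N * (v0 ^+ 2 + v1 ^+ 2).
  rewrite -subr_ge0 NE; have -> : (X ^+ 2 + Y ^+ 2) * (v0 ^+ 2 + v1 ^+ 2) -
    (X * v0 + Y * v1) ^+ 2 = (X * v1 - Y * v0) ^+ 2 by ring.
  exact: sqr_ge0.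
have v2 : 0 <= v0 ^+ 2 + v1 ^+ 2 by rewrite addr_ge0 ?sqr_ge0.
apply: (@le_trans _ _ ((2 * g / N) ^+ 2 * (N * (v0 ^+ 2 + v1 ^+ 2)))).
  by rewrite ler_wpM2l ?sqr_ge0.
rewrite mulrA ler_wpM2r//.
have -> : (2 * g / N) ^+ 2 * N = (2 * g) ^+ 2 / N by field; exact: lt0r_neq0.
have g1 : (2 * g) ^+ 2 * (C + `|T| / 2) ^+ 2 <= 1.
  have -> : (2 * g) ^+ 2 * (C + `|T| / 2) ^+ 2 =
      ((`|T| * (C + `|T| / 2)) / (2 * C * (1 + T ^+ 2))) ^+ 2.
    have T2 : T ^+ 2 = `|T| ^+ 2 by rewrite real_normK ?num_real.
    have -> : (2 * g) ^+ 2 = T ^+ 2 / (2 * C * (1 + T ^+ 2)) ^+ 2.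
      by rewrite /g; field; rewrite !lt0r_neq0.
    by rewrite {1}T2; field; rewrite !lt0r_neq0.
  rewrite expr_le1//; last by rewrite divr_ge0 ?mulr_ge0// ltW.
  rewrite ler_pdivrMr ?mulr_gt0// mul1r -[T ^+ 2]real_normK ?num_real//.
  move: `|T| (normr_ge0 T) C1; clear=> t t0 C1.
  rewrite -subr_ge0.
  have -> : 2 * C * (1 + t ^+ 2) - t * (C + t / 2) =
    C * (2 - t + t ^+ 2) + (C - 2^-1) * t ^+ 2 by field.
  rewrite addr_ge0// mulr_ge0 ?sqr_ge0//; last by lra.
    by lra.
  have -> : 2 - t + t ^+ 2 = (t - 2^-1) ^+ 2 + (2 - 4^-1) by field.
  by rewrite addr_ge0 ?sqr_ge0//; lra.
rewrite ler_pdivrMr//.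
have D2 : 0 < (C + `|T| / 2) ^+ 2 by rewrite exprn_gt0.
by rewrite -(ler_pM2r D2) (le_trans g1)// -mulrA.
Qed.

Lemma speed_bound u c t a (C : R) : 1 <= C -> c t != a ->
  - (lnsq a (c t) / 2) - ln (C + `|lnsq a (c t)| / 2) <= u (c t) ->
  `|height1 (8 * C)^-1 a (c t) 0 * derive1 c t 0 0
    + height1 (8 * C)^-1 a (c t) 1 * derive1 c t 0 1| <= speed u c t.
Proof.
move=> C1 ca hu; have s0 := sqdist_gt0 ca.
have D0 : 0 < C + `|lnsq a (c t)| / 2.
  by rewrite ltr_wpDr ?divr_ge0// (lt_le_trans _ C1).
rewrite /speed gnorm2_conformal; apply: height1_bound => //.
have : 2 * (- (lnsq a (c t) / 2) - ln (C + `|lnsq a (c t)| / 2)) <= 2 * u (c t).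
  by rewrite ler_pM2l.
rewrite -ler_expR; set l := ln (C + _).
have -> : 2 * (- (lnsq a (c t) / 2) - l) = - (lnsq a (c t) + (l + l)) by field.
rewrite expRN expRD expRD lnK// lnK// -(expr2 (C + _)).
have P0 : 0 < sqdist a (c t) * (C + `|lnsq a (c t)| / 2) ^+ 2.
  by rewrite mulr_gt0// exprn_gt0.
by move=> h; rewrite -[leLHS](mulVf (lt0r_neq0 P0)) ler_pM2r.
Qed.

Lemma arc_height W u a (C : R) c : ~ W a -> 1 <= C ->
  (forall x, W x -> {for x, continuous u}) ->
  (forall x, W x -> - (lnsq a x / 2) - ln (C + `|lnsq a x| / 2) <= u x) ->
  C1_arc W c ->
  (`|height (8 * C)^-1 a (c 1) - height (8 * C)^-1 a (c 0)|%:E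
     <= arc_length (conformal u) c)%E.
Proof.
move=> Wa C1 cu hu ac; have [dc cdc Wc] := ac.
have ca t : 0 <= t <= 1 -> c t != a.
  by move=> t01; apply: contra_notN Wa => /eqP <-; exact: Wc.
apply: (@arc_length_ge _ W u c (fun s => height (8 * C)^-1 a (c s))
  (fun t => height1 (8 * C)^-1 a (c t) 0 * derive1 c t 0 0
     + height1 (8 * C)^-1 a (c t) 1 * derive1 c t 0 1) ac cu).
- by move=> t t01; apply: is_derive_height; [exact: dc|exact: ca].
- move=> t t01.
  have ch i : {for t, continuous (fun s => height1 (8 * C)^-1 a (c s) i)}.
    apply: (@continuous_comp _ _ _ c (fun x => height1 (8 * C)^-1 a x i)).
      exact: continuous_arc.
    exact: continuous_height1 (ca t t01).
  apply: continuousD.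
    by apply: continuousM; [exact: ch|exact: continuous_derive_arc].
  by apply: continuousM; [exact: ch|exact: continuous_derive_arc].
- move=> t t01; apply: speed_bound => //; first exact: ca.
  exact/hu/Wc.
Qed.

(** [height] is 1-Lipschitz on each arc, hence along each path. *)
Lemma riem_dist_height W u a (C : R) p q : ~ W a -> 1 <= C ->
  (forall x, W x -> {for x, continuous u}) ->
  (forall x, W x -> - (lnsq a x / 2) - ln (C + `|lnsq a x| / 2) <= u x) ->
  (`|height (8 * C)^-1 a q - height (8 * C)^-1 a p|%:E
     <= riem_dist W (conformal u) p q)%E.
Proof.
move=> Wa C1 cu hu; apply: le_ereal_inf_tmp => _ [cs pcs <-].
elim: cs p pcs => [|c cs IH] p /=.
  by move=> ->; rewrite subrr normr0 /path_length big_nil.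
move=> [ac <- pcs]; rewrite /path_length big_cons -/(path_length _ cs).
apply: le_trans (leeD (arc_height Wa C1 cu hu ac) (IH _ pcs)).
rewrite -EFinD lee_fin [leRHS]addrC.
exact: ler_distD.
Qed.

Lemma path_between_rcons W p q cs c : path_between W p cs q -> C1_arc W c ->
  c 0 = q -> path_between W p (rcons cs c) (c 1).
Proof.
move=> + ac c0; elim: cs p => [|d cs IH] p /=; first by move=> ->; split.
by move=> [ad d0 /IH].
Qed.

Definition segment x y : R -> 'rV[R]_2 := fun t => x + t *: (y - x).

Lemma is_derive_segment x y (t : R) : is_derive t 1 (segment x y) (y - x).
Proof.
have d (i : 'I_1) (j : 'I_2) : is_derive t 1 (fun s => segment x y s i j) ((y - x) i j).
  have -> : (fun s => segment x y s i j) = (fun s : R => x i j + s * (y - x) i j).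
    by apply/funext => s; rewrite /segment !mxE.
  by apply: is_derive_eq; rewrite /GRing.scale/=; ring.
have dm : derivable (segment x y) t 1.
  by apply/derivable_mxP => i j; case: (d i j).
split; first exact: dm.
by rewrite derive_mx//; apply/matrixP => i j; rewrite mxE; case: (d i j).
Qed.

Lemma segment_length W u p x y (r B : R) : 0 <= B ->
  (forall z, `|z - p| < r -> W z /\ expR (2 * u z) <= B ^+ 2) ->
  (forall z, W z -> {for z, continuous u}) ->
  `|x - p| < r -> `|y - p| < r ->
  C1_arc W (segment x y) /\
  (arc_length (conformal u) (segment x y) <= (2 * B * `|y - x|)%:E)%E.
Proof.
move=> B0 H cu xr yr.
have d1 t : derive1 (segment x y) t = y - x.
  by rewrite derive1E; case: (is_derive_segment x y t).
have inb t : 0 <= t <= 1 -> `|segment x y t - p| < r.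
  move=> /andP[t0 t1].
  have -> : segment x y t - p = (1 - t) *: (x - p) + t *: (y - p).
    by apply/rowP => i; rewrite !mxE; ring.
  rewrite (le_lt_trans (ler_normD _ _))// !normrZ (ger0_norm t0) ger0_norm ?subr_ge0//.
  have [t'|t'] := eqVneq t 0.
    by rewrite t' subr0 mul1r mul0r addr0.
  have {}t0 : 0 < t by rewrite lt0r t'.
  apply: (@lt_le_trans _ _ ((1 - t) * r + t * r)); last by rewrite -mulrDl subrK mul1r.
  by rewrite ler_ltD// ?ler_wpM2l ?subr_ge0 ?(ltW xr)// ltr_pM2l.
have ac : C1_arc W (segment x y).
  split.
  - by move=> t; case: (is_derive_segment x y t).
  - have -> : derive1 (segment x y) = cst (y - x) by apply/funext.
    exact: cst_continuous.
  - by move=> t t01; case: (H _ (inb t t01)).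
split=> //; apply: (arc_length_le ac cu) => t t01.
have [_ hB] := H _ (inb t t01).
rewrite /speed gnorm2_conformal d1.
have e0 : 0 <= 2 * B * `|y - x| by rewrite !mulr_ge0.
rewrite -[leRHS]ger0_norm// -sqrtr_sqr ler_sqrt ?sqr_ge0//.
have n2 i : (y - x) 0 i ^+ 2 <= `|y - x| ^+ 2.
  by rewrite -real_normK ?num_real// ler_pXn2r ?nnegrE// coord_le_norm.
apply: (@le_trans _ _ (B ^+ 2 * (`|y - x| ^+ 2 + `|y - x| ^+ 2))).
  by rewrite ler_pM ?expR_ge0 ?addr_ge0 ?sqr_ge0// lerD.
rewrite !exprMn; move: (B ^+ 2) (`|y - x| ^+ 2) (sqr_ge0 B) (sqr_ge0 `|y - x|) => b n b0 n0.
have -> : 2 ^+ 2 * b * n = b * (n + n) + 2 * (b * n) by ring.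
by rewrite lerDl !mulr_ge0.
Qed.

End riemannian_distance.

(** * Completeness *)

Section completeness.
Context {R : realType}.
Implicit Types (u : 'rV[R]_2 -> R) (a p q x y : 'rV[R]_2) (i j : 'I_2).
Implicit Types (W : set 'rV[R]_2) (xs : nat -> 'rV[R]_2).

Definition log_lower_bound W u a := exists2 C : R, 1 <= C &
  forall x, W x -> - (lnsq a x / 2) - ln (C + `|lnsq a x| / 2) <= u x.

Definition riem_cauchy W u xs := forall e : R, 0 < e -> exists N : nat,
  forall m n : nat, (N <= m)%N -> (N <= n)%N ->
    (riem_dist W (conformal u) (xs m) (xs n) < e%:E)%E.

Lemma height_proper (kap K a : R) : 0 < kap -> kap * ln (1 + a ^+ 2) <= K ->
  `|a| <= expR (K / kap).
Proof.
move=> k0 h; have p0 : 0 < 1 + a ^+ 2 by rewrite ltr_wpDr// sqr_ge0.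
have : ln (1 + a ^+ 2) <= K / kap by rewrite ler_pdivlMr// mulrC.
rewrite -ler_expR lnK// => /(le_trans _); apply.
rewrite -real_normK ?num_real//; move: `|a| (normr_ge0 a); clear=> t t0.
rewrite -subr_ge0; have -> : 1 + t ^+ 2 - t = (t - 2^-1) ^+ 2 + (1 - 4^-1) by field.
by rewrite addr_ge0 ?sqr_ge0//; lra.
Qed.

(** [height] is bounded on the sequence and controls [lnsq a], so the sequence stays
bounded and away from [a]. *)
Lemma riem_cauchy_lnsq W u a xs : ~ W a ->
  (forall x, W x -> {for x, continuous u}) -> log_lower_bound W u a ->
  riem_cauchy W u xs ->
  exists M : R, exists N : nat, forall n, (N <= n)%N -> `|lnsq a (xs n)| <= M.
Proof.
move=> Wa cu [C C1 hC] xc; have [N HN] := xc 1 ltr01.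
have C0 : 0 < C by exact: lt_le_trans C1.
have k0 : 0 < (8 * C)^-1 by rewrite invr_gt0 mulr_gt0.
exists (expR ((height (8 * C)^-1 a (xs N) + 1) / (8 * C)^-1)); exists N => n Nn.
apply: height_proper => //.
have := le_lt_trans (riem_dist_height (xs N) (xs n) Wa C1 cu hC) (HN N n (leqnn N) Nn).
rewrite lte_fin -/(height (8 * C)^-1 a (xs n)) => h.
by rewrite addrC -lerBlDr (le_trans (ler_norm _))// ltW.
Qed.

Lemma sqdist_norm a x : `|x - a| ^+ 2 <= sqdist a x.
Proof.
rewrite -(ler_sqrt _ (sqdist_ge0 a x)) sqrtr_sqr normr_id.
apply: norm_le_coord; first exact: sqrtr_ge0.
move=> i; rewrite -sqrtr_sqr ler_sqrt ?sqdist_ge0// !mxE /sqdist.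
by case: (ord2P i) => ->; rewrite ?lerDl ?lerDr sqr_ge0.
Qed.

Lemma sqdist_le a x : sqdist a x <= 2 * `|x - a| ^+ 2.
Proof.
have h i : (x 0 i - a 0 i) ^+ 2 <= `|x - a| ^+ 2.
  rewrite -real_normK ?num_real// ler_pXn2r ?nnegrE//.
  by have := coord_le_norm (x - a) i; rewrite !mxE.
by rewrite mulr_natl mulr2n lerD.
Qed.

(** A Cauchy sequence is bounded, so it has a cluster point [p]; it stays away from
each point outside [W], so [p] is in [W]; short segments then join [p] to
infinitely many terms. *)
Lemma conformal_complete W u : open W ->
  (forall x, W x -> {for x, continuous u}) -> ~` W !=set0 ->
  (forall a, ~ W a -> log_lower_bound W u a) ->
  riem_complete W (conformal u).
Proof.
move=> oW cu [a0 Wa0] hlog xs Wxs xc.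
have [M [N0 HM]] := riem_cauchy_lnsq Wa0 cu (hlog _ Wa0) xc.
have xa a n : ~ W a -> xs n != a.
  by move=> Wa; apply: contra_notN Wa => /eqP <-.
have inK n : (N0 <= n)%N -> `|xs n - a0| <= 1 + expR M.
  move=> n0.
  have h : `|xs n - a0| ^+ 2 <= expR M.
    apply: le_trans (sqdist_norm _ _) _.
    rewrite -[leLHS](lnK (sqdist_gt0 (xa a0 n Wa0))) ler_expR.
    exact: le_trans (ler_norm _) (HM n n0).
  apply: le_trans (_ : 1 + `|xs n - a0| ^+ 2 <= _); last by rewrite lerD2l.
  move: `|_| ; clear=> t; rewrite -subr_ge0.
  have -> : 1 + t ^+ 2 - t = (t - 2^-1) ^+ 2 + (1 - 4^-1) by field.
  by rewrite addr_ge0 ?sqr_ge0//; lra.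
have [p [_ clp]] : [set x | `|x - a0| <= 1 + expR M] `&` cluster (xs @ \oo) !=set0.
  apply: (@compact_norm_ball R a0 (1 + expR M)).
  by exists N0 => // n /= /inK.
have near_p (N : nat) (r : R) : 0 < r -> exists2 n, (N <= n)%N & `|xs n - p| < r.
  move=> r0.
  have [z [[n Nn <-] zr]] : (xs @` [set n | (N <= n)%N]) `&` [set z | `|z - p| < r] !=set0.
    apply: clp; first by exists N => // n Nn; exists n.
    by apply/near_normP; exists r.
  by exists n.
have Wp : W p.
  apply: contrapT => nWp.
  have [M' [N1 HM']] := riem_cauchy_lnsq nWp cu (hlog _ nWp) xc.
  have e0 : 0 < expR (- M') / 2 by rewrite divr_gt0// expR_gt0.
  have r0 : 0 < Num.sqrt (expR (- M') / 2) by rewrite sqrtr_gt0.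
  have [n Nn xr] := near_p N1 _ r0.
  have h1 : expR (- M') <= sqdist p (xs n).
    rewrite -[leRHS](lnK (sqdist_gt0 (xa p n nWp))) ler_expR lerNl.
    by rewrite (le_trans (ler_norm _))// normrN HM'.
  have h2 : `|xs n - p| ^+ 2 < expR (- M') / 2.
    by rewrite -(sqr_sqrtr (ltW e0)) ltr_pXn2r ?nnegrE// ltW.
  move: h1 (sqdist_le p (xs n)) h2.
  move: (expR _) (sqdist _ _) (`|_| ^+ 2); clear=> E s t h1 h2 h3.
  by lra.
exists p => // e e0.
have [r1 r10 H1] : exists2 r : R, 0 < r & forall z, `|z - p| < r -> W z.
  by apply/near_normP; apply: open_nbhs_nbhs.
have [r2 r20 H2] := continuous_norm (cu p Wp) ltr01.
have [r r0 [rr1 rr2]] := exists_lt_both r10 r20.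
(* By continuity [expR (u z)] is at most [B] on a ball around [p]. *)
pose B := expR (u p + 1).
have B0 : 0 < B by exact: expR_gt0.
have HB z : `|z - p| < r -> W z /\ expR (2 * u z) <= B ^+ 2.
  move=> zr; split; first exact: H1 (lt_trans zr rr1).
  rewrite /B -expRM_natl ler_expR ler_pM2l//.
  by have := H2 z (lt_trans zr rr2); rewrite ltr_norml ltrBlDr => /andP[h _];
    move: h; rewrite ltrBrDr => h; rewrite ltW// -ltrBlDr addrC.
have e2 : 0 < e / 2 by rewrite divr_gt0.
have [N HN] := xc _ e2.
have s0 : 0 < e / 2 / (2 * B) by rewrite divr_gt0// mulr_gt0.
have [s s00 [sr se]] := exists_lt_both r0 s0.
have [k Nk xk] := near_p N s s00.
exists N => n Nn.
have [_ [cs pcs <-] hl] := ereal_inf_lt (HN n k Nn Nk).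
have pr : `|p - p| < r by rewrite subrr normr0.
have [ac al] := segment_length (ltW B0) HB cu (lt_trans xk sr) pr.
have pcs' := path_between_rcons pcs ac (_ : segment (xs k) p 0 = xs k).
apply: (@le_lt_trans _ _ (path_length (conformal u) (rcons cs (segment (xs k) p)))).
  apply: ereal_inf_lbound; exists (rcons cs (segment (xs k) p)) => //=.
  have {2}-> : p = segment (xs k) p 1 by rewrite /segment scale1r addrC subrK.
  by apply: pcs'; rewrite /segment scale0r addr0.
rewrite /path_length big_rcons/= (splitr e) EFinD.
apply: lteD; first exact: hl.
apply: le_lt_trans al _; rewrite lte_fin distrC mulrC -ltr_pdivlMr ?mulr_gt0//.
exact: lt_trans xk se.
Qed.

End completeness.

(** * Poincare metrics of an exhaustion *)

Theorem proposition4p1 (R : realType) (Om : set 'rV[R]_2)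
    (Omn : nat -> set 'rV[R]_2) (un : nat -> 'rV[R]_2 -> R)
    (Om_nonempty : Om !=set0)
    (Om_open : open Om)
    (Om_connected : connected Om)
    (Om_compl : exists a b : 'rV[R]_2, [/\ a != b, ~ Om a & ~ Om b])
    (Omn_bounded : forall n, bounded_set (Omn n))
    (Omn_open : forall n, open (Omn n))
    (Omn_connected : forall n, connected (Omn n))
    (Omn_smooth : forall n, smooth_boundary (Omn n))
    (Omn_nested : forall n, compactly_inside (Omn n) (Omn n.+1))
    (Omn_sub : forall n, Omn n `<=` Om)
    (Omn_exhaust : forall K : set 'rV[R]_2, compact K -> K `<=` Om ->
       exists N : nat, forall n : nat, (N <= n)%N -> K `<=` Omn n)
    (un_smooth : forall n, smooth_on (Omn n) (un n))
    (un_eq : forall n p, Omn n p -> laplacian (un n) p = expR (2 * un n p))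
    (un_blowup : forall n, boundary_blowup (Omn n) (un n))
    (un_complete : forall n,
       complete_metric_tensor (Omn n) (conformal (un n))) :
  exists u : 'rV[R]_2 -> R,
    [/\ (forall n p, Omn n p -> un n.+1 p <= un n p) /\
        (forall p, Om p -> un ^~ p @ \oo --> u p),
        smooth_on Om u,
        (forall p, Om p -> laplacian u p = expR (2 * u p)),
        complete_metric_tensor Om (conformal u) &
        (forall p, Om p -> gauss_curvature (conformal u) p = -1)].
Proof.
have sol n : solution (Omn n) (un n) by split; [exact: un_smooth|exact: un_eq].
have clO n : closure (Omn n) `<=` Omn n.+1 by case: (Omn_nested n).
have bu n : blowup (Omn n) (un n) by exact: boundary_blowupP.
have ex : exhausted_by Omn Om by exact: exhausted_by_compact.
have dec n p : Omn n p -> un n.+1 p <= un n p.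
  move=> Op.
  exact: (solution_decreasing (Omn_open n) (Omn_bounded n) (clO n) (sol n) (bu n)
    (sol n.+1) Op).
have avoid a b n q : ~ Om a -> ~ Om b -> closure (Omn n) q -> q != a /\ q != b.
  move=> Oa Ob /clO /Omn_sub Oq.
  by split; [apply: contra_notN Oa|apply: contra_notN Ob] => /eqP <-.
have other a : ~ Om a -> exists2 b, a != b & ~ Om b.
  move=> Oa; have [c [d [cd Oc Od]]] := Om_compl.
  have [ac|ac] := eqVneq a c; last by exists c.
  by exists d => //; rewrite ac.
have [a [b [ab Oa Ob]]] := Om_compl.
have [c lower] := two_puncture_lower ab.
pose w x := profile (lnsq a x) + profile (lnsq b x) + c.
have w_lower n p : Omn n p -> w p <= un n p.
  apply: lower; first exact: Omn_open.
  - exact: Omn_bounded.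
  - exact: solution_super.
  - exact: bu.
  - by move=> q; exact: avoid.
have w_cont p : Om p -> {for p, continuous w}.
  move=> Op; have pa : p != a by apply: contra_notN Oa => /eqP <-.
  have pb : p != b by apply: contra_notN Ob => /eqP <-.
  apply: continuousD; last exact: cst_continuous.
  apply: continuousD; first exact: (continuous_radial pa (is_derive_profile _)).
  exact: (continuous_radial pb (is_derive_profile _)).
pose u p := lim (un ^~ p @ \oo).
have un_u p : Om p -> un ^~ p @ \oo --> u p.
  exact: (un_pointwise_cvg ex clO dec w_lower).
have Ck k : Ck_cvg Omn Om k un u.
  exact: (limit_smooth ex Omn_open clO sol dec w_cont w_lower).
have su : smooth_on Om u by exact: (Ck_smooth ex Ck).
have se : smooth_on Om (fun p => expR (2 * u p)).
  by apply: (Ck_smooth ex) => k; exact: (Ck_exp2 ex Omn_open (Ck k)).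
have eventually p : Om p -> exists N : nat, forall n, (N <= n)%N -> Omn n p.
  move=> Op; have [r r0 [N H]] := exhausted_nbhs ex Op.
  by exists N => n Nn; apply: (H n p Nn _).1; rewrite subrr normr0.
have eu p : Om p -> laplacian u p = expR (2 * u p).
  move=> Op; have [N HN] := eventually p Op.
  rewrite -(cvg_lim (@norm_hausdorff _ _) (Ck2_laplacian (Ck 2%N) Op)).
  apply: cvg_lim; first exact: norm_hausdorff.
  have := ccvg_pointwise (Ck_ccvg (Ck_exp2 ex Omn_open (Ck 0%N))) Op.
  apply: cvg_trans; apply: near_eq_cvg.
  by exists N => // n /= Nn; rewrite un_eq//; exact: HN.
have cu p : Om p -> {for p, continuous u} by exact: smooth_continuous.
have log_u a' : ~ Om a' -> log_lower_bound Om u a'.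
  move=> Oa'; have [b' ab' Ob'] := other a' Oa'.
  have [C C1 HC] := log_bound ab'; exists C => // p Op.
  have [N HN] := eventually p Op.
  apply: (cvgr_to_ge (un_u p Op)); exists N => // n /= Nn.
  apply: (HC (Omn n) (un n)); last exact: HN.
  - exact: Omn_open.
  - exact: Omn_bounded.
  - exact: solution_super.
  - exact: bu.
  - by move=> q; exact: avoid.
exists u; split.
- by split; [exact: dec|exact: un_u].
- exact: su.
- exact: eu.
- split; first exact: metric_tensor_conformal.
  by apply: conformal_complete => //; exists a.
- move=> p Op; rewrite (gauss_curvature_conformal Om_open su Op) eu//.
  by rewrite mulNr divff// gt_eqF// expR_gt0.
Qed.
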